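(* Let $W_{\mathrm{af}}$ be an untwisted affine Weyl group with finite index set $I$. Let $J, K_1, K_2, \ldots, K_s \subset I$ be such that $J = \bigcap_{\nu=1}^s K_\nu$, and let $x, y \in (W^J)_{\mathrm{af}}$. Then $x \succeq y$ in $(W^J)_{\mathrm{af}}$ if and only if $\Pi^{K_\nu}(x) \succeq \Pi^{K_\nu}(y)$ in $(W^{K_\nu})_{\mathrm{af}}$ for all $\nu \in \{1,\ldots,s\}$, where $\succeq$ denotes the semi-infinite Bruhat order.
   Context: Let $\Delta$ be the root system of a complex finite-dimensional simple Lie algebra, with simple roots $\alpha_i$ ($i\in I$), simple coroots $\alpha_i^\vee$, positive roots $\Delta^+$, coroot lattice $Q^\vee=\bigoplus_{i\in I}\mathbb{Z}\alpha_i^\vee$, Weyl group $W=\langle r_i\mid i\in I\rangle$ with length function $\ell$, and $\rho=\frac12\sum_{\alpha\in\Delta^+}\alpha$. The (untwisted) affine Weyl group is $W_{\mathrm{af}}=W\ltimes\{t_\xi\mid \xi\in Q^\vee\}$ with $t_\xi t_\zeta=t_{\xi+\zeta}$ and $wt_\xi w^{-1}=t_{w\xi}$. The real affine roots are $\Delta_{\mathrm{af}}=\{\alpha+n\delta\mid \alpha\in\Delta,n\in\mathbb{Z}\}$ with positive ones $\Delta^+_{\mathrm{af}}=\Delta^+\sqcup\{\alpha+n\delta\mid\alpha\in\Delta,n>0\}$; the action is $wt_\xi(\alpha+n\delta)=w\alpha+(n-\langle\xi,\alpha\rangle)\delta$, and the reflection in $\beta=\alpha+n\delta$ is $r_\beta=r_\alpha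 t_{n\alpha^\vee}$. For $J\subset I$: $Q_J^\vee=\bigoplus_{j\in J}\mathbb{Z}\alpha_j^\vee$, $\Delta_J=\Delta\cap\bigoplus_{j\in J}\mathbb{Z}\alpha_j$, $\Delta_J^+=\Delta_J\cap\Delta^+$, $W_J=\langle r_j\mid j\in J\rangle$, $(\Delta_J)^+_{\mathrm{af}}=\Delta_J^+\sqcup\{\alpha+n\delta\mid\alpha\in\Delta_J,n>0\}$, $(W_J)_{\mathrm{af}}=W_J\ltimes\{t_\xi\mid\xi\in Q_J^\vee\}$, and $(W^J)_{\mathrm{af}}=\{x\in W_{\mathrm{af}}\mid x\beta\in\Delta^+_{\mathrm{af}}\text{ for all }\beta\in(\Delta_J)^+_{\mathrm{af}}\}$. Each $x\in W_{\mathrm{af}}$ factors uniquely as $x=x_1x_2$ with $x_1\in(W^J)_{\mathrm{af}}$, $x_2\in(W_J)_{\mathrm{af}}$; set $\Pi^J(x)=x_1$. The semi-infinite length is $\ell^{\frac{\infty}{2}}(wt_\xi)=\ell(w)+2\langle\xi,\rho\rangle$. The semi-infinite Bruhat graph $\mathrm{SiB}^J$ is the directed graph with vertex set $(W^J)_{\mathrm{af}}$ and edges $x\xrightarrow{\beta}r_\beta x$ for $x\in(W^J)_{\mathrm{af}}$, $\beta\in\Delta^+_{\mathrm{af}}$ with $r_\beta x\in(W^J)_{\mathrm{af}}$ and $\ell^{\frac{\infty}{2}}(r_\beta x)=\ell^{\frac{\infty}{2}}(x)+1$. The semi-infinite Bruhat order on $(W^J)_{\mathrm{af}}$ is: $x\succeq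 y$ iff there is a directed path (possibly trivial) from $y$ to $x$ in $\mathrm{SiB}^J$. *)

(* Defs.v *)
From HB Require Import structures.
From Stdlib Require Import Relation_Operators.
From mathcomp Require Import all_boot all_order all_algebra.
From mathcomp Require Import finmap.
From mathcomp Require Import boolp classical_sets reals.

Set Implicit Arguments.
Unset Strict Implicit.
Unset Printing Implicit Defensive.

Import Order.TTheory GRing.Theory Num.Theory.

Local Open Scope ring_scope.

Section Euclidean.
Variables (R : realType) (n : nat).
Implicit Types u v a : 'cV[R]_n.

Definition dot u v : R := (u^T *m v) 0 0.

(* The Euclidean structure identifies the space of coroots with that of the
   roots, so that the pairing of a coroot with a root is [dot]. *)
Definition coroot a : 'cV[R]_n := (2 / dot a a) *: a.

Definition reflection a : 'M[R]_n := 1%:M - a *m (coroot a)^T.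

Definition int_span (f : 'I_n -> 'cV[R]_n) (J : {set 'I_n}) v : Prop :=
  exists c : 'I_n -> int, v = \sum_(j in J) (c j)%:~R *: f j.

Definition nat_span (f : 'I_n -> 'cV[R]_n) v : Prop :=
  exists c : 'I_n -> nat, v = \sum_i (c i)%:R *: f i.

End Euclidean.

(* A reduced irreducible crystallographic root system of rank n, realised in
   the Euclidean space R^n, with a choice of simple roots. *)
Record simpleRootSystem (R : realType) (n : nat) := SimpleRootSystem {
  roots :> {fset 'cV[R]_n};
  simple_root : 'I_n -> 'cV[R]_n;
  root_neq0 : 0 \notin roots;
  root_span : <<enum_fset roots>>%VS = fullv;
  root_reflection : forall a b, a \in roots -> b \in roots ->
    reflection a *m b \in roots;
  root_integral : forall a b, a \in roots -> b \in roots ->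
    dot (coroot a) b \is a Num.int;
  root_reduced : forall a (c : R), a \in roots -> c *: a \in roots ->
    c = 1 \/ c = -1;
  roots_neq0 : roots != fset0;
  root_irreducible : forall A : {fset 'cV[R]_n},
    (A `<=` roots)%fset -> A != fset0 ->
    (forall a b, a \in A -> b \in (roots `\` A)%fset -> dot a b = 0) ->
    A = roots;
  simple_root_in : forall i, simple_root i \in roots;
  simple_root_basis : basis_of fullv [seq simple_root i | i : 'I_n];
  simple_root_sign : forall a, a \in roots ->
    nat_span simple_root a \/ nat_span simple_root (- a)
}.

Section SemiInfinite.
Variables (R : realType) (n : nat) (D : simpleRootSystem R n).
Implicit Types (J : {set 'I_n}) (w : 'M[R]_n) (xi : 'cV[R]_n).

Local Notation alpha := (simple_root D).

Definition simple_coroot (i : 'I_n) : 'cV[R]_n := coroot (alpha i).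

Definition pos_roots : {fset 'cV[R]_n} :=
  [fset a in roots D | `[< nat_span alpha a >]]%fset.

Definition rho : 'cV[R]_n := 2^-1 *: \sum_(a <- pos_roots) a.

Definition word (l : seq 'I_n) : 'M[R]_n :=
  \prod_(i <- l) reflection (alpha i).

(* Simple reflections are involutions, so words in them, without inverses,
   exhaust the subgroup they generate. *)
Definition weyl_parabolic J w : Prop :=
  exists2 l : seq 'I_n, all (mem J) l & w = word l.

Definition weyl w : Prop := weyl_parabolic [set: 'I_n] w.

Definition has_word_of_size w (k : nat) : Prop :=
  exists2 l : seq 'I_n, size l = k & w = word l.

Definition weyl_length w : nat :=
  xget 0%N (fun k : nat => has_word_of_size w k /\
    forall m : nat, has_word_of_size w m -> (k <= m)%N).

(* The pair (w, xi) stands for w t_xi. *)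
Definition affine : Type := ('M[R]_n * 'cV[R]_n)%type.

(* w t_xi w' t_xi' = w w' t_(w'^-1 xi + xi') *)
Definition affine_mul (x y : affine) : affine :=
  (x.1 *m y.1, invmx y.1 *m x.2 + y.2).

Definition affine_weyl (x : affine) : Prop :=
  weyl x.1 /\ int_span simple_coroot [set: 'I_n] x.2.

Definition affine_weyl_parabolic J (x : affine) : Prop :=
  weyl_parabolic J x.1 /\ int_span simple_coroot J x.2.

(* The pair (a, k) stands for a + k delta; k is an integer for a root. *)
Definition affine_vector : Type := ('cV[R]_n * R)%type.

Definition affine_act (x : affine) (b : affine_vector) : affine_vector :=
  (x.1 *m b.1, b.2 - dot x.2 b.1).

Definition affine_reflection (b : affine_vector) : affine :=
  (reflection b.1, b.2 *: coroot b.1).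

Definition root_in J (a : 'cV[R]_n) : Prop :=
  a \in roots D /\ int_span alpha J a.

Definition pos_affine_root_in J (b : affine_vector) : Prop :=
  root_in J b.1 /\
  (b.1 \in pos_roots /\ b.2 = 0 \/ b.2 \is a Num.int /\ 0 < b.2).

Definition pos_affine_root (b : affine_vector) : Prop :=
  b.1 \in roots D /\
  (b.1 \in pos_roots /\ b.2 = 0 \/ b.2 \is a Num.int /\ 0 < b.2).

Definition affine_min_coset J (x : affine) : Prop :=
  affine_weyl x /\
  forall b, pos_affine_root_in J b -> pos_affine_root (affine_act x b).

(* The factorisation exists and is unique for x in the affine Weyl group;
   elsewhere the value is irrelevant. *)
Definition affine_proj J (x : affine) : affine :=
  xget x (fun x1 : affine => affine_min_coset J x1 /\
    exists2 x2, affine_weyl_parabolic J x2 & x = affine_mul x1 x2).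

Definition semi_infinite_length (x : affine) : R :=
  (weyl_length x.1)%:R + 2 * dot x.2 rho.

Definition semi_infinite_edge J (x y : affine) : Prop :=
  [/\ affine_min_coset J x, affine_min_coset J y &
    exists b, [/\ pos_affine_root b, y = affine_mul (affine_reflection b) x &
      semi_infinite_length y = semi_infinite_length x + 1]].

Definition semi_infinite_ge J (x y : affine) : Prop :=
  clos_refl_trans affine (semi_infinite_edge J) y x.

End SemiInfinite.

(* Main.v *)
Require Import Defs.
From Stdlib Require Import Relation_Operators.
From mathcomp Require Import all_boot all_order all_algebra.
From mathcomp Require Import finmap.
From mathcomp Require Import boolp classical_sets reals.
From mathcomp Require Import ring lra zify.

(** The proof reduces the comparison of [x] and [y], simultaneously for all subsets
    [J], to a comparison of two translations, where it can be read off.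

    For translations, [trans xi] lies above [trans zeta] modulo [J] if and only
    if the coordinates of [xi - zeta] off [J] are nonnegative ([sge_transE]).  An
    index is outside of the intersection of the [K nu] if and only if it is outside
    of some [K nu], so for translations the theorem is immediate.

    The reduction ([reduce_to_translations]) lowers [x] by simple affine
    reflections until it is a translation.  At each step [y] is replaced by the
    lower one of itself and its image, as in Deodhar's argument for Coxeter
    groups.  By the lifting property of the order ([up_down_edge]) this changes
    no comparison modulo any [J] ([sge_lower]).  In contrast with the Bruhat
    order there is no least element at which to stop.  Instead [x] goes down
    through a sequence of translations by [- rhoc set0], and between two of them
    [y] cannot follow at every step unless it is a translation as well; on the
    other hand the difference of the lengths stays bounded below.

    Everything rests on the numbers [cnt z e], which count with sign the
    hyperplanes in direction [e] that separate two alcoves.  Their sum [slen J]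
    over the positive roots [e] off [J] is invariant under the parabolic subgroup
    and agrees with the semi-infinite length on minimal representatives.  A
    reflection in an affine root of positive direction off [J] raises [slen J]
    exactly if the affine root stays positive ([slen_refl_lt]); this sign rule
    replaces the strong exchange condition.  The weak order is given by the
    comparison of all [cnt z e] ([descent_ind]); it yields the sequences of
    simple reflections above, generation by simple reflections and hence the
    existence of coset projections, and the chain property ([sge_refl_lt]), by
    which a reflection that raises [slen J] by any amount goes up in the
    order. *)

Set Implicit Arguments.
Unset Strict Implicit.
Unset Printing Implicit Defensive.

Import Order.TTheory GRing.Theory Num.Theory.

Local Open Scope ring_scope.

Local Notation set0 := finset.set0.

(** * The Euclidean space and its reflections *)

Section Euclidean.
Variables (R : realType) (n : nat).
Implicit Types (u v a b : 'cV[R]_n) (w : 'M[R]_n).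

Lemma dotE u v : dot u v = \sum_i u i 0 * v i 0.
Proof. by rewrite /dot mxE; apply: eq_bigr => i _; rewrite mxE. Qed.

Lemma dotC u v : dot u v = dot v u.
Proof. by rewrite !dotE; apply: eq_bigr => i _; rewrite mulrC. Qed.

Lemma dotDl u v a : dot (u + v) a = dot u a + dot v a.
Proof. by rewrite /dot linearD mulmxDl mxE. Qed.

Lemma dotZl (c : R) u v : dot (c *: u) v = c * dot u v.
Proof. by rewrite /dot linearZ -scalemxAl mxE. Qed.

Lemma dotDr u v a : dot a (u + v) = dot a u + dot a v.
Proof. by rewrite dotC dotDl !(dotC a). Qed.

Lemma dotZr (c : R) u v : dot u (c *: v) = c * dot u v.
Proof. by rewrite dotC dotZl dotC. Qed.

Lemma dotNl u v : dot (- u) v = - dot u v.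
Proof. by rewrite -scaleN1r dotZl mulN1r. Qed.

Lemma dotNr u v : dot u (- v) = - dot u v.
Proof. by rewrite dotC dotNl dotC. Qed.

Lemma dotBl u v a : dot (u - v) a = dot u a - dot v a.
Proof. by rewrite dotDl dotNl. Qed.

Lemma dotBr u v a : dot a (u - v) = dot a u - dot a v.
Proof. by rewrite dotDr dotNr. Qed.

Lemma dot0l u : dot 0 u = 0.
Proof. by rewrite -(scale0r 0) dotZl mul0r. Qed.

Lemma dot_suml I (r : seq I) (P : pred I) (F : I -> 'cV[R]_n) v :
  dot (\sum_(i <- r | P i) F i) v = \sum_(i <- r | P i) dot (F i) v.
Proof.
by apply: (big_morph (fun u => dot u v)) => [x y|]; rewrite ?dotDl ?dot0l.
Qed.

Lemma dot_sumr I (r : seq I) (P : pred I) (F : I -> 'cV[R]_n) v :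
  dot v (\sum_(i <- r | P i) F i) = \sum_(i <- r | P i) dot v (F i).
Proof. by rewrite dotC dot_suml; apply: eq_bigr => i _; rewrite dotC. Qed.

Lemma dot_ge0 u : 0 <= dot u u.
Proof. by rewrite dotE; apply: sumr_ge0 => i _; rewrite -expr2 sqr_ge0. Qed.

Lemma dot_gt0 u : (0 < dot u u) = (u != 0).
Proof.
rewrite lt_def dot_ge0 andbT; congr (~~ _); apply/eqP/eqP => [|->]; last first.
  by rewrite dot0l.
rewrite dotE => /psumr_eq0P H; apply/matrixP => i j; rewrite ord1 mxE.
by apply/eqP; rewrite -sqrf_eq0 expr2 H // => k _; rewrite -expr2 sqr_ge0.
Qed.

Lemma dot_coroot a b : dot (coroot a) b = 2 * dot a b / dot a a.
Proof. by rewrite /coroot dotZl; ring. Qed.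

Lemma dot_coroot_self a : a != 0 -> dot (coroot a) a = 2.
Proof. by rewrite -dot_gt0 dot_coroot => a0; rewrite mulfK ?gt_eqF. Qed.

Lemma dot_coroot_swap a b :
  dot (coroot a) b *: a = dot a b *: coroot a.
Proof. by rewrite dot_coroot /coroot scalerA; congr (_ *: _); ring. Qed.

Lemma dot_coroot_gt0 a b : a != 0 -> (0 < dot (coroot a) b) = (0 < dot a b).
Proof.
rewrite -dot_gt0 => a0; rewrite dot_coroot -mulrA mulrCA pmulr_lgt0 //.
by rewrite divr_gt0.
Qed.

Lemma corootN a : coroot (- a) = - coroot a.
Proof. by rewrite /coroot dotNl dotNr opprK scalerN. Qed.

Lemma reflectionE a v : reflection a *m v = v - dot (coroot a) v *: a.
Proof.
rewrite /reflection mulmxBl mul1mx -mulmxA.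
by rewrite [_^T *m v]mx11_scalar mul_mx_scalar.
Qed.

Lemma reflectionN a : reflection (- a) = reflection a.
Proof. by rewrite /reflection corootN linearN /= mulmxN mulNmx opprK. Qed.

Lemma tr_reflection a : (reflection a)^T = reflection a.
Proof.
rewrite /reflection linearB /= trmx1 trmx_mul trmxK /coroot; congr (_ - _).
by rewrite linearZ /= -scalemxAr -scalemxAl.
Qed.

Lemma reflection_self a : a != 0 -> reflection a *m a = - a.
Proof.
move=> a0; rewrite reflectionE dot_coroot_self // scaler_nat mulr2n.
by rewrite opprD addrA subrr sub0r.
Qed.

Lemma reflectionK a v : a != 0 -> reflection a *m (reflection a *m v) = v.
Proof.
move=> a0; rewrite reflectionE [reflection a *m v]reflectionE.
rewrite dotBr dotZr dot_coroot_self // -addrA -opprD -scalerDl.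
set p := dot _ v; have -> : p + (p - p * 2) = 0 by ring.
by rewrite scale0r subr0.
Qed.

Lemma mulmx_ext w w' : (forall v, w *m v = w' *m v) -> w = w'.
Proof.
move=> H; apply/matrixP => i j.
have /matrixP/(_ i 0) := H (delta_mx j 0).
by rewrite -!colE !mxE.
Qed.

Lemma reflection_sq a : a != 0 -> reflection a *m reflection a = 1%:M.
Proof.
by move=> a0; apply: mulmx_ext => v; rewrite -mulmxA reflectionK // mul1mx.
Qed.

Lemma dot_mulmx w u v : dot (w *m u) v = dot u (w^T *m v).
Proof. by rewrite /dot trmx_mul mulmxA. Qed.

Lemma dot_reflection a u v :
  dot (reflection a *m u) v = dot u (reflection a *m v).
Proof. by rewrite dot_mulmx tr_reflection. Qed.

(** The strict Cauchy-Schwarz inequality.  Between roots the two factors are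
    integers of the same sign, which leaves 0, 1, 2 and 3 for their product. *)
Lemma coroot_pairing_lt4 a b : a != 0 -> b != 0 ->
  b != (dot (coroot a) b / 2) *: a ->
  dot (coroot a) b * dot (coroot b) a < 4.
Proof.
move=> a0 b0 hb.
have ha : 0 < dot a a by rewrite dot_gt0.
have hbb : 0 < dot b b by rewrite dot_gt0.
have := dot_gt0 (b - (dot (coroot a) b / 2) *: a); rewrite subr_eq0 hb.
rewrite !dot_coroot (dotC b a) dotBl !dotBr !dotZl !dotZr (dotC b a).
set s := dot a b; set p := dot a a in ha *; set q := dot b b in hbb *.
move=> H; rewrite (_ : _ * _ = 4 * (s ^+ 2 / (p * q))); last by field; lra.
suff : s ^+ 2 / (p * q) < 1 by lra.
rewrite ltr_pdivrMr ?mulr_gt0 // mul1r.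
set N := (X in 0 < X) in H; have : 0 < p * N by rewrite mulr_gt0.
have -> : p * N = p * q - s ^+ 2 by rewrite /N; field; lra.
by rewrite subr_gt0.
Qed.

End Euclidean.

(** * Coordinates and heights of roots *)

Section Roots.
Variables (R : realType) (n : nat) (D : simpleRootSystem R n).
Implicit Types (J : {set 'I_n}) (w : 'M[R]_n) (a b v xi : 'cV[R]_n).

Local Notation alpha := (simple_root D).
Local Notation Phi := (Defs.roots D).

Definition simple_mx : 'M[R]_n := \matrix_(i, j) alpha j i 0.

Definition coef (i : 'I_n) v : R := (invmx simple_mx *m v) i 0.

(** The coordinates of a root have the same sign, so the sign of [ht J] on it
    tells apart the roots of the parabolic [J] (sign zero) and the positive and
    the negative roots off [J].  The ordinary height is [ht set0]. *)
Definition ht J v : R := \sum_(i | i \notin J) coef i v.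

Lemma simple_mx_mul v : simple_mx *m v = \sum_i v i 0 *: alpha i.
Proof.
apply/matrixP => i j; rewrite ord1 mxE summxE; apply: eq_bigr => k _.
by rewrite !mxE mulrC.
Qed.

Lemma simple_mx_unit : simple_mx \in unitmx.
Proof.
have span v : exists c : 'cV[R]_n, simple_mx *m c = v.
  have := memvf v; have /andP[/eqP <- _] := simple_root_basis D.
  rewrite -[X in v \in <<X>>%VS]in_tupleE => /coord_span ->.
  elim/big_ind: _ => [|x y [c <-] [d <-]|k _].
  - by exists 0; rewrite mulmx0.
  - by exists (c + d); rewrite mulmxDr.
  have /mapP[j _ ->] : (in_tuple [seq alpha i | i : 'I_n])`_k \in
      [seq alpha i | i : 'I_n].
    by apply: mem_nth.
  set c := coord _ _ _; exists (c *: delta_mx j 0).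
  rewrite -scalemxAr; congr (_ *: _).
  rewrite simple_mx_mul (bigD1 j) //= mxE !eqxx scale1r.
  by rewrite big1 ?addr0 // => i /negPf ij; rewrite mxE ij scale0r.
have [B hB] : exists B : 'M[R]_n, simple_mx *m B = 1%:M.
  have /choice[f hf] : forall j, exists c : 'cV[R]_n, simple_mx *m c = delta_mx j 0.
    by move=> j; apply: span.
  exists (\matrix_(i, j) f j i 0); apply/matrixP => i j.
  have /matrixP/(_ i 0) := hf j; rewrite !mxE eqxx andbT => <-.
  by apply: eq_bigr => k _; rewrite !mxE.
by have [] := mulmx1_unit hB.
Qed.

Lemma coefD i u v : coef i (u + v) = coef i u + coef i v.
Proof. by rewrite /coef mulmxDr mxE. Qed.

Lemma coefZ i (c : R) v : coef i (c *: v) = c * coef i v.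
Proof. by rewrite /coef -scalemxAr mxE. Qed.

Lemma coefN i v : coef i (- v) = - coef i v.
Proof. by rewrite -scaleN1r coefZ mulN1r. Qed.

Lemma coef_sum i (I : Type) (r : seq I) (P : pred I) (F : I -> 'cV[R]_n) :
  coef i (\sum_(k <- r | P k) F k) = \sum_(k <- r | P k) coef i (F k).
Proof. by rewrite /coef mulmx_sumr summxE. Qed.

Lemma coef_expand v : v = \sum_i coef i v *: alpha i.
Proof. by rewrite -simple_mx_mul mulKVmx // simple_mx_unit. Qed.

Lemma coef_alpha i j : coef i (alpha j) = (i == j)%:R.
Proof.
have -> : alpha j = simple_mx *m delta_mx j 0.
  rewrite simple_mx_mul (bigD1 j) //= mxE !eqxx scale1r big1 ?addr0 // => k kj.
  by rewrite mxE (negPf kj) scale0r.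
by rewrite /coef mulKmx ?simple_mx_unit // mxE eqxx andbT.
Qed.

Lemma coef_comb i (P : pred 'I_n) (c : 'I_n -> R) :
  coef i (\sum_(j | P j) c j *: alpha j) = if P i then c i else 0.
Proof.
rewrite coef_sum; case: ifP => Pi.
  rewrite (bigD1 i) //= coefZ coef_alpha eqxx mulr1 big1 ?addr0 // => j.
  by case/andP=> _ /negPf ji; rewrite coefZ coef_alpha eq_sym ji mulr0.
rewrite big1 // => j Pj; rewrite coefZ coef_alpha.
by case: eqP => [ij|]; rewrite ?mulr0 //; rewrite ij Pj in Pi.
Qed.

Lemma htD J u v : ht J (u + v) = ht J u + ht J v.
Proof. by rewrite /ht -big_split; apply: eq_bigr => i _; rewrite coefD. Qed.

Lemma htZ J (c : R) v : ht J (c *: v) = c * ht J v.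
Proof. by rewrite /ht big_distrr; apply: eq_bigr => i _; rewrite coefZ. Qed.

Lemma htN J v : ht J (- v) = - ht J v.
Proof. by rewrite -scaleN1r htZ mulN1r. Qed.

Lemma ht_sum J (I : Type) (r : seq I) (P : pred I) (F : I -> 'cV[R]_n) :
  ht J (\sum_(k <- r | P k) F k) = \sum_(k <- r | P k) ht J (F k).
Proof.
rewrite /ht exchange_big /=; apply: eq_bigr => i _; exact: coef_sum.
Qed.

Lemma ht_alpha J i : ht J (alpha i) = (i \notin J)%:R.
Proof.
rewrite /ht; case: (boolP (i \in J)) => iJ.
  rewrite big1 // => j jJ; rewrite coef_alpha; case: eqP => // ji.
  by rewrite ji iJ in jJ.
rewrite (bigD1 i) //= coef_alpha eqxx big1 ?addr0 // => j /andP[_ /negPf ji].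
by rewrite coef_alpha ji.
Qed.

Lemma root_nz a : a \in Phi -> a != 0.
Proof. by apply: contraTneq => ->; exact: root_neq0. Qed.

Lemma rootN a : a \in Phi -> - a \in Phi.
Proof.
by move=> aD; rewrite -reflection_self ?root_nz // root_reflection.
Qed.

Lemma rootNE a : (- a \in Phi) = (a \in Phi).
Proof. by apply/idP/idP => /rootN; rewrite ?opprK. Qed.

Lemma nat_span_coef a :
  nat_span alpha a -> forall i, coef i a \is a Num.nat.
Proof. by move=> [c ->] i; rewrite coef_comb natr_nat. Qed.

Lemma root_coef_int a i : a \in Phi -> coef i a \is a Num.int.
Proof.
case/simple_root_sign=> /nat_span_coef/(_ i).
  exact: Num.Theory.intr_nat.
by rewrite coefN => /Num.Theory.intr_nat; rewrite rpredN.
Qed.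

Lemma root_coef_sign a : a \in Phi ->
  (forall i, 0 <= coef i a) \/ (forall i, coef i a <= 0).
Proof.
case/simple_root_sign=> /nat_span_coef h; [left|right] => i.
  exact: natr_ge0 (h i).
by rewrite -oppr_ge0 -coefN; exact: natr_ge0 (h i).
Qed.

Lemma ht_int J a : a \in Phi -> ht J a \is a Num.int.
Proof. by move=> aD; apply: rpred_sum => i _; exact: root_coef_int. Qed.

Lemma ht_ge0 J a : (forall i, 0 <= coef i a) -> 0 <= ht J a.
Proof. by move=> h; apply: sumr_ge0 => i _. Qed.

Lemma ht_le0 J a : (forall i, coef i a <= 0) -> ht J a <= 0.
Proof. by move=> h; apply: sumr_le0 => i _. Qed.

Lemma ht_eq0_coef J a i : a \in Phi -> ht J a = 0 -> i \notin J -> coef i a = 0.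
Proof.
move=> aD ha iN; case: (root_coef_sign aD) => h.
  by apply: (psumr_eq0P (fun k _ => h k) ha).
have h' k : k \notin J -> 0 <= - coef k a by rewrite oppr_ge0.
apply/eqP; rewrite -oppr_eq0; apply/eqP; apply: (psumr_eq0P h') => //.
by rewrite sumrN -/(ht J a) ha oppr0.
Qed.

Lemma ht0_neq0 a : a \in Phi -> ht set0 a != 0.
Proof.
move=> aD; apply: contraTneq (root_nz aD); rewrite negbK => ha.
rewrite [a]coef_expand; apply/eqP/big1 => i _.
by rewrite (ht_eq0_coef aD ha) ?scale0r // inE.
Qed.

Lemma pos_coef a i : a \in Phi -> 0 < ht set0 a -> 0 <= coef i a.
Proof.
move=> aD; case: (root_coef_sign aD) => // /(ht_le0 set0) h.
by rewrite ltNge h.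
Qed.

Lemma ht_gt0W J a : a \in Phi -> 0 < ht J a -> 0 < ht set0 a.
Proof.
move=> aD; case: (root_coef_sign aD) => h.
  by move=> _; rewrite lt_def ht0_neq0 // ht_ge0.
by rewrite ltNge ht_le0.
Qed.

Lemma ht_geW J a : a \in Phi -> 0 < ht set0 a -> 0 <= ht J a.
Proof. by move=> aD h; apply: ht_ge0 => i; exact: pos_coef. Qed.

Lemma pos_rootsE a : (a \in pos_roots D) = (a \in Phi) && (0 < ht set0 a).
Proof.
rewrite !inE /=; case: (boolP (a \in Phi)) => //= aD.
apply/asboolP/idP => [/nat_span_coef h|h].
  by rewrite lt_def ht0_neq0 // ht_ge0 // => i; exact: natr_ge0.
case: (simple_root_sign aD) => // /nat_span_coef h'.
have := ht_ge0 set0 (fun i => natr_ge0 (h' i)).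
by rewrite htN oppr_ge0 leNgt h.
Qed.

Lemma root_inE J a : root_in D J a <-> a \in Phi /\ ht J a = 0.
Proof.
split=> [[aD [c ac]]|[aD ha]]; split=> //.
  by apply: big1 => i /negPf iJ; rewrite ac coef_comb iJ.
have /choice[c hc] : forall i, exists m : int, coef i a = m%:~R.
  by move=> i; apply/intrP/root_coef_int.
exists c; rewrite {1}[a]coef_expand big_mkcond [RHS]big_mkcond.
apply: eq_bigr => i _ /=; rewrite -hc; case: ifP => // /negbT iJ.
by rewrite (ht_eq0_coef aD ha) // scale0r.
Qed.

Lemma alpha_nz i : alpha i != 0.
Proof. by rewrite root_nz // simple_root_in. Qed.

Lemma coef_reflection i j v : i != j ->
  coef i (reflection (alpha j) *m v) = coef i v.
Proof.
move=> /negPf ij; rewrite reflectionE coefD coefN coefZ coef_alpha ij.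
by rewrite mulr0 oppr0 addr0.
Qed.

(** A positive root other than [alpha j] has a positive coordinate that the
    reflection does not touch. *)
Lemma simple_reflection_pos j a : a \in Phi -> 0 < ht set0 a -> a != alpha j ->
  0 < ht set0 (reflection (alpha j) *m a).
Proof.
move=> aD ha aj.
have raD : reflection (alpha j) *m a \in Phi.
  by rewrite root_reflection // simple_root_in.
have [i ij hi] : exists2 i, i != j & coef i a != 0.
  apply: contrapT => hN.
  have ac : a = coef j a *: alpha j.
    rewrite {1}[a]coef_expand (bigD1 j) //= big1 ?addr0 // => i ij.
    suff /eqP-> : coef i a == 0 by rewrite scale0r.
    by apply: contrapT => /negP hi; apply: hN; exists i.
  have aD' := aD; rewrite ac in aD'.
  have [c1|c1] := root_reduced (simple_root_in D j) aD'.
    by rewrite ac c1 scale1r eqxx in aj.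
  by rewrite ac c1 htZ ht_alpha inE mulN1r oppr_gt0 ltr10 in ha.
have ci : 0 < coef i a by rewrite lt_def hi pos_coef.
rewrite ltNge; apply/negP; case: (root_coef_sign raD) => h.
  rewrite le_eqVlt (negPf (ht0_neq0 raD)) /= => /ltW.
  by rewrite leNgt lt_def ht0_neq0 // ht_ge0.
by move=> _; have := h i; rewrite coef_reflection // leNgt ci.
Qed.

End Roots.

(** * The finite Weyl group *)

Section Weyl.
Variables (R : realType) (n : nat) (D : simpleRootSystem R n).
Implicit Types (J : {set 'I_n}) (w : 'M[R]_n) (a b v xi : 'cV[R]_n).

Local Notation alpha := (simple_root D).
Local Notation Phi := (Defs.roots D).
Local Notation wordD := (word D).

Lemma word_cat l1 l2 : wordD (l1 ++ l2) = wordD l1 *m wordD l2.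
Proof. by rewrite /word big_cat. Qed.

Lemma word_cons i l : wordD (i :: l) = reflection (alpha i) *m wordD l.
Proof. by rewrite /word big_cons. Qed.

Lemma word_nil : wordD [::] = 1%:M.
Proof. by rewrite /word big_nil. Qed.

Lemma word_rcons l i : wordD (rcons l i) = wordD l *m reflection (alpha i).
Proof. by rewrite -cats1 word_cat word_cons word_nil mulmx1. Qed.

Lemma tr_word l : (wordD l)^T = wordD (rev l).
Proof.
elim: l => [|i l IH]; first by rewrite word_nil trmx1.
by rewrite word_cons trmx_mul IH tr_reflection rev_cons word_rcons.
Qed.

Lemma word_orthogonal l : (wordD l)^T *m wordD l = 1%:M.
Proof.
elim: l => [|i l IH]; first by rewrite word_nil trmx1 mulmx1.
rewrite word_cons trmx_mul tr_reflection -mulmxA (mulmxA (reflection _)).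
by rewrite reflection_sq ?alpha_nz // mul1mx.
Qed.

Lemma word_root l a : a \in Phi -> wordD l *m a \in Phi.
Proof.
move=> aD; elim: l => [|i l IH]; first by rewrite word_nil mul1mx.
by rewrite word_cons -mulmxA root_reflection // simple_root_in.
Qed.

Lemma parabolic_weyl J w : weyl_parabolic D J w -> weyl D w.
Proof. by move=> [l _ ->]; exists l => //; apply/allP => i; rewrite inE. Qed.

Lemma parabolic1 J : weyl_parabolic D J 1%:M.
Proof. by exists [::]; rewrite ?word_nil. Qed.

Lemma parabolicM J w w' : weyl_parabolic D J w -> weyl_parabolic D J w' ->
  weyl_parabolic D J (w *m w').
Proof.
move=> [l hl ->] [l' hl' ->]; exists (l ++ l'); last by rewrite word_cat.
by rewrite all_cat hl.
Qed.

Lemma parabolicV J w : weyl_parabolic D J w -> weyl_parabolic D J w^T.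
Proof.
by move=> [l hl ->]; exists (rev l); rewrite ?tr_word // all_rev.
Qed.

Lemma parabolic_simple J j : j \in J ->
  weyl_parabolic D J (reflection (alpha j)).
Proof.
by move=> jJ; exists [:: j]; rewrite /= ?jJ // word_cons word_nil mulmx1.
Qed.

Lemma weyl1 : weyl D 1%:M.
Proof. exact: parabolic1. Qed.

Lemma weylM w w' : weyl D w -> weyl D w' -> weyl D (w *m w').
Proof. exact: parabolicM. Qed.

Lemma weylV w : weyl D w -> weyl D w^T.
Proof. exact: parabolicV. Qed.

Lemma weyl_trK w : weyl D w -> w^T *m w = 1%:M.
Proof. by move=> [l _ ->]; exact: word_orthogonal. Qed.

Lemma weyl_Ktr w : weyl D w -> w *m w^T = 1%:M.
Proof. by move=> /weylV/weyl_trK; rewrite trmxK. Qed.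

Lemma weyl_invmx w : weyl D w -> invmx w = w^T.
Proof.
move=> hw; have [_ u] := mulmx1_unit (weyl_trK hw).
by rewrite -[LHS]mul1mx -(weyl_trK hw) -mulmxA mulmxV // mulmx1.
Qed.

Lemma weyl_mulKmx w v : weyl D w -> w^T *m (w *m v) = v.
Proof. by move=> hw; rewrite mulmxA weyl_trK // mul1mx. Qed.

Lemma weyl_mulVmx w v : weyl D w -> w *m (w^T *m v) = v.
Proof. by move=> hw; rewrite mulmxA weyl_Ktr // mul1mx. Qed.

Lemma weyl_root w a : weyl D w -> (w *m a \in Phi) = (a \in Phi).
Proof.
move=> hw; apply/idP/idP => h; last by case: hw => l _ ->; exact: word_root.
by rewrite -(weyl_mulKmx a hw); case: (weylV hw) => l _ ->; exact: word_root.
Qed.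

Lemma dot_weyl w u v : weyl D w -> dot (w *m u) (w *m v) = dot u v.
Proof. by move=> hw; rewrite dot_mulmx weyl_mulKmx. Qed.

Lemma weyl_inj w : weyl D w -> injective (mulmx w : 'cV[R]_n -> _).
Proof.
by move=> hw u v e; rewrite -(weyl_mulKmx u hw) e weyl_mulKmx.
Qed.

Lemma coroot_weyl w a : weyl D w -> coroot (w *m a) = w *m coroot a.
Proof. by move=> hw; rewrite /coroot dot_weyl // -scalemxAr. Qed.

Lemma reflection_weyl w a : weyl D w ->
  reflection (w *m a) *m w = w *m reflection a.
Proof.
move=> hw; apply: mulmx_ext => v; rewrite -!mulmxA !reflectionE.
by rewrite coroot_weyl // dot_weyl // mulmxBr -scalemxAr.
Qed.

Lemma coef_parabolic J w i v : weyl_parabolic D J w -> i \notin J ->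
  coef D i (w *m v) = coef D i v.
Proof.
move=> [l hl ->] iJ; elim: l hl => [|j l IH] /=; first by rewrite word_nil mul1mx.
case/andP=> jJ hl; rewrite word_cons -mulmxA coef_reflection ?IH //.
by apply: contraNneq iJ => ->.
Qed.

Lemma ht_parabolic J w v : weyl_parabolic D J w -> ht D J (w *m v) = ht D J v.
Proof. by move=> hw; apply: eq_bigr => i iJ; apply: coef_parabolic iJ. Qed.

Lemma pairing_int a b : a \in Phi -> b \in Phi -> dot (coroot a) b \is a Num.int.
Proof. exact: root_integral. Qed.

Lemma int_ge1 (x : R) : x \is a Num.int -> 0 < x -> 1 <= x.
Proof. by move=> /intrP[m ->]; rewrite ltr0z ler1z. Qed.

(** * The coroot lattice *)

Local Notation qspan := (int_span (simple_coroot D)).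

Lemma qspan0 J : qspan J 0.
Proof. by exists (fun=> 0); rewrite big1 // => i _; rewrite scale0r. Qed.

Lemma qspanD J u v : qspan J u -> qspan J v -> qspan J (u + v).
Proof.
move=> [c ->] [d ->]; exists (fun i => c i + d i); rewrite -big_split.
by apply: eq_bigr => i _; rewrite rmorphD scalerDl.
Qed.

Lemma qspanN J u : qspan J u -> qspan J (- u).
Proof.
move=> [c ->]; exists (fun i => - c i); rewrite -sumrN.
by apply: eq_bigr => i _; rewrite rmorphN scaleNr.
Qed.

Lemma qspanZ J (x : R) u : x \is a Num.int -> qspan J u -> qspan J (x *: u).
Proof.
move=> /intrP[m ->] [c ->]; exists (fun i => m * c i); rewrite scaler_sumr.
by apply: eq_bigr => i _; rewrite scalerA rmorphM.
Qed.

Lemma qspan_simple J j : j \in J -> qspan J (simple_coroot D j).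
Proof.
move=> jJ; exists (fun i => (i == j)%:Z); rewrite (bigD1 j) //= eqxx scale1r.
by rewrite big1 ?addr0 // => i /andP[_ /negPf ->]; rewrite scale0r.
Qed.

Lemma qspan_sum J (I : eqType) (r : seq I) (P : pred I) (F : I -> 'cV[R]_n) :
  (forall i, i \in r -> P i -> qspan J (F i)) -> qspan J (\sum_(i <- r | P i) F i).
Proof.
move=> h; rewrite big_seq_cond; elim/big_ind: _ => [|u v|i /andP[ir Pi]].
- exact: qspan0.
- exact: qspanD.
- exact: h.
Qed.

Lemma coef_coroot i a : coef D i (coroot a) = 2 / dot a a * coef D i a.
Proof. by rewrite /coroot coefZ. Qed.

Lemma qspan_coef J v i : qspan J v -> i \notin J -> coef D i v = 0.
Proof.
move=> [c ->] iJ; rewrite coef_sum big1 // => j jJ.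
rewrite coefZ coef_coroot coef_alpha; case: eqP => [ij|_]; last by rewrite !mulr0.
by rewrite ij jJ in iJ.
Qed.

Lemma dot_qspan J v a : qspan J v -> a \in Phi -> dot v a \is a Num.int.
Proof.
move=> [c ->] aD; rewrite dot_suml; apply: rpred_sum => i _.
by rewrite dotZl rpredM ?rpred_int // pairing_int // simple_root_in.
Qed.

Lemma qspan_sub J (K : {set 'I_n}) v : J \subset K -> qspan J v -> qspan K v.
Proof.
move=> /fintype.subsetP JK [c ->]; apply: qspan_sum => i _ iJ.
by apply: qspanZ; rewrite ?rpred_int //; apply/qspan_simple/JK.
Qed.

Lemma qspanT J v : qspan J v -> qspan [set: 'I_n] v.
Proof. exact/qspan_sub/finset.subsetT. Qed.

Lemma qspan_parabolic J w v : weyl_parabolic D J w -> qspan J v ->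
  qspan J (w *m v).
Proof.
move=> [l hl ->] hv; elim: l hl => [|j l IH] /=; first by rewrite word_nil mul1mx.
case/andP=> jJ /IH h; rewrite word_cons -mulmxA reflectionE.
rewrite dot_coroot_swap dotC; apply: qspanD => //; apply: qspanN.
apply: qspanZ; last exact: qspan_simple.
by apply: dot_qspan h _; exact: simple_root_in.
Qed.

(** By descent on the height: some simple root [alpha i] with [i] in the
    support of [a] pairs positively with [a], and reflecting in it lowers the
    height unless [a = alpha i]. *)
Lemma reflection_parabolic_pos J a : a \in Phi -> ht D J a = 0 ->
  0 < ht D set0 a ->
  weyl_parabolic D J (reflection a) /\ qspan J (coroot a).
Proof.
move=> aD; have /intrP[[m|m] hm] := ht_int set0 aD; last first.
  by rewrite hm ltr0z.
elim/ltn_ind: m a aD hm => m IH a aD hm ha pa.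
have [i ci di] : exists2 i, 0 < coef D i a & 0 < dot (alpha i) a.
  apply: contrapT => hN; have := dot_gt0 a; rewrite (root_nz aD).
  rewrite {1}[a](coef_expand D) dot_suml ltNge => /negP; apply.
  apply: sumr_le0 => i _; rewrite dotZl.
  have c0 := pos_coef i aD pa; have [d0|d0] := leP (dot (alpha i) a) 0.
    by rewrite mulr_ge0_le0.
  have [-> |cN] := eqVneq (coef D i a) 0; first by rewrite mul0r.
  by case: hN; exists i => //; rewrite lt_def cN.
have iJ : i \in J.
  by apply: contraTT ci => /(ht_eq0_coef aD ha) ->; rewrite ltxx.
have [->|ai] := eqVneq a (alpha i).
  by split; [exact: parabolic_simple|exact: qspan_simple].
set r := reflection (alpha i); have hr : weyl_parabolic D J r.
  exact: parabolic_simple.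
have hrW := parabolic_weyl hr.
have raD : r *m a \in Phi by rewrite weyl_root.
have pra : 0 < ht D set0 (r *m a) by apply: simple_reflection_pos.
have hra : ht D J (r *m a) = 0 by rewrite ht_parabolic.
have rr : r *m r = 1%:M by rewrite reflection_sq ?alpha_nz.
have [m' hm'] : exists m' : nat, ht D set0 (r *m a) = m'%:~R.
  have /intrP[[k|k] hk] := ht_int set0 raD; first by exists k.
  by rewrite hk ltr0z in pra.
have lt_m : (m' < m)%N.
  rewrite -(ltr_nat R) -[m'%:R]hm' -[m%:R]hm reflectionE htD htN htZ ht_alpha inE.
  rewrite mulr1 ltrBlDr ltrDl.
  by rewrite dot_coroot_gt0 ?alpha_nz.
have [h1 h2] := IH m' lt_m (r *m a) raD hm' hra pra.
have -> : a = r *m (r *m a) by rewrite reflectionK ?alpha_nz.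
split; last by rewrite coroot_weyl //; exact: qspan_parabolic.
rewrite -[reflection _]mulmx1 -rr mulmxA reflection_weyl //.
by apply: parabolicM => //; apply: parabolicM.
Qed.

Lemma reflection_parabolic J a : a \in Phi -> ht D J a = 0 ->
  weyl_parabolic D J (reflection a) /\ qspan J (coroot a).
Proof.
move=> aD ha; have := ht0_neq0 aD; rewrite neq_lt => /orP[hn|hp]; last first.
  exact: reflection_parabolic_pos.
have [|||h1 h2] := @reflection_parabolic_pos J (- a).
- exact: rootN.
- by rewrite htN ha oppr0.
- by rewrite htN oppr_gt0.
by move: h1 (qspanN h2); rewrite reflectionN corootN opprK.
Qed.

Lemma ht_setT v : ht D [set: 'I_n] v = 0.
Proof. by apply: big_pred0 => i; rewrite inE. Qed.

Lemma weyl_reflection a : a \in Phi -> weyl D (reflection a).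
Proof. by move=> aD; have [] := reflection_parabolic aD (ht_setT a). Qed.

Lemma qspan_coroot a : a \in Phi -> qspan [set: 'I_n] (coroot a).
Proof. by move=> aD; have [] := reflection_parabolic aD (ht_setT a). Qed.

(** * Inversions and length *)

Lemma sum_weyl (V : nmodType) w (F : 'cV[R]_n -> V) : weyl D w ->
  \sum_(a <- Phi) F (w *m a) = \sum_(a <- Phi) F a.
Proof.
move=> hw; rewrite -(big_map (mulmx w) xpredT F); apply: perm_big.
apply: uniq_perm; first by rewrite map_inj_uniq ?fset_uniq //; exact: weyl_inj.
  exact: fset_uniq.
move=> b; apply/mapP/idP => [[a aD ->]|bD]; first by rewrite weyl_root.
by exists (w^T *m b); rewrite ?weyl_mulVmx // weyl_root //; exact: weylV.
Qed.

Lemma sum_weyl_cond (V : nmodType) w (P : pred 'cV[R]_n) (F : 'cV[R]_n -> V) :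
  weyl D w ->
  \sum_(a <- Phi | P (w *m a)) F (w *m a) = \sum_(a <- Phi | P a) F a.
Proof.
move=> hw; rewrite big_mkcond [RHS]big_mkcond.
exact: (sum_weyl (fun a => if P a then F a else 0) hw).
Qed.

Definition ninv w : nat :=
  \sum_(a <- Phi | 0 < ht D set0 a) (ht D set0 (w *m a) < 0)%R.

Lemma ninv_descent w i : weyl D w -> ht D set0 (w *m alpha i) < 0 ->
  ninv w = (ninv (w *m reflection (alpha i))).+1.
Proof.
move=> hw hi; set r := reflection _.
have hr : weyl D r by apply: weyl_reflection; exact: simple_root_in.
have aD := simple_root_in D i.
have pa : 0 < ht D set0 (alpha i) by rewrite ht_alpha inE ltr01.
have rr v : r *m (r *m v) = v by rewrite reflectionK ?alpha_nz.
have ra : r *m alpha i = - alpha i by rewrite reflection_self ?alpha_nz.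
rewrite /ninv (bigID (pred1 (alpha i))) [in RHS](bigID (pred1 (alpha i))) /=.
have one (F : 'cV[R]_n -> nat) :
    \sum_(a <- Phi | (0 < ht D set0 a) && (a == alpha i)) F a = F (alpha i).
  rewrite big_mkcond (bigD1_seq (alpha i)) ?fset_uniq //= pa eqxx /=.
  by rewrite big1 ?addr0 // => a /negPf ->; rewrite andbF.
rewrite !one -mulmxA ra mulmxN htN oppr_lt0 hi ltNge ltW //=.
set A := (X in (1 + X)%N = _); set B := (X in _ = (0 + X)%N.+1).
suff: A = B by move=> ->.
rewrite /A -(sum_weyl_cond _ _ hr).
rewrite big_seq_cond [RHS]big_seq_cond; apply: eq_big => [a|a _]; last first.
  by rewrite -mulmxA.
case: (boolP (a \in Phi)) => //= aD'.
have key b : b \in Phi -> (0 < ht D set0 b) && (b != alpha i) ->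
    (0 < ht D set0 (r *m b)) && (r *m b != alpha i).
  move=> bD /andP[pb bN]; rewrite simple_reflection_pos //=.
  apply: contraTneq pb => e; rewrite -(rr b) e ra htN oppr_gt0.
  by rewrite ltNge ltW.
apply/idP/idP => [/key|]; first by rewrite weyl_root // rr => /(_ aD').
exact: key.
Qed.

(** The exchange condition. *)
Lemma word_exchange l i : ht D set0 (wordD l *m alpha i) < 0 ->
  exists2 l', (size l').+1 = size l & wordD l *m reflection (alpha i) = wordD l'.
Proof.
elim: l => [|j l IH].
  by rewrite word_nil mul1mx ht_alpha inE ltr10.
have hwl : weyl D (wordD l) by exists l => //; apply/allP => k; rewrite inE.
have laD : wordD l *m alpha i \in Phi by rewrite word_root // simple_root_in.
rewrite word_cons -mulmxA => h.
have [pl|] := boolP (0 < ht D set0 (wordD l *m alpha i)); last first.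
  rewrite -leNgt le_eqVlt (negPf (ht0_neq0 laD)) /= => /IH[l' hl' el'].
  by exists (j :: l'); rewrite /= ?hl' // word_cons -mulmxA el'.
have [e|ne] := eqVneq (wordD l *m alpha i) (alpha j); last first.
  have := simple_reflection_pos laD pl ne.
  by move=> /ltW; rewrite leNgt h.
exists l => //; rewrite -mulmxA -reflection_weyl // e mulmxA.
by rewrite reflection_sq ?alpha_nz // mul1mx.
Qed.

Lemma weyl_ninv0 w : weyl D w -> ninv w = 0%N -> w = 1%:M.
Proof.
move=> [l _ ->]; have [k] := ubnP (size l); elim: k l => // k IH l.
case/lastP: l => [|l i]; first by rewrite word_nil.
rewrite size_rcons ltnS => hk h0.
have hw : weyl D (wordD (rcons l i)).
  by exists (rcons l i) => //; apply/allP => j; rewrite inE.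
have aD := simple_root_in D i.
have hi : ht D set0 (wordD l *m alpha i) < 0.
  have: ~~ (ht D set0 (wordD (rcons l i) *m alpha i) < 0).
    by apply/negP => /(ninv_descent hw); rewrite h0.
  rewrite word_rcons -mulmxA reflection_self ?alpha_nz // mulmxN htN oppr_lt0.
  rewrite -leNgt le_eqVlt (negPf (ht0_neq0 _)) //.
  exact: word_root.
have [l' hl' e] := word_exchange hi.
rewrite word_rcons e; apply: IH; last by rewrite -e -word_rcons.
by rewrite (leq_trans _ hk) // -hl'.
Qed.

Lemma ninv_word l : (ninv (wordD l) <= size l)%N.
Proof.
elim/last_ind: l => [|l i IH].
  rewrite word_nil /ninv big1 // => a pa.
  by rewrite mul1mx ltNge ltW.
have hw : weyl D (wordD l) by exists l => //; apply/allP => k; rewrite inE.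
have aD := simple_root_in D i.
have wD : wordD l *m alpha i \in Phi by exact: word_root.
have hr : weyl D (reflection (alpha i)) by exact: weyl_reflection.
rewrite size_rcons word_rcons.
have [h|] := boolP (ht D set0 (wordD l *m alpha i) < 0).
  by rewrite (leq_trans _ (leqW IH)) // (ninv_descent hw h).
rewrite -leNgt le_eqVlt eq_sym (negPf (ht0_neq0 wD)) /= => h.
rewrite (ninv_descent (weylM hw hr) (i := i)); last first.
  by rewrite -mulmxA reflection_self ?alpha_nz // mulmxN htN oppr_lt0.
by rewrite -mulmxA reflection_sq ?alpha_nz // mulmx1.
Qed.

Lemma ninv_descent_ex w : weyl D w -> (0 < ninv w)%N ->
  exists i, ht D set0 (w *m alpha i) < 0.
Proof.
move=> hw; apply: contraPP => hN; apply/negP; rewrite -leqNgt leqn0; apply/eqP.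
rewrite /ninv big_seq_cond big1 // => a /andP[aD pa]; apply/eqP.
rewrite eqb0 -leNgt [a](coef_expand D) mulmx_sumr.
rewrite ht_sum; apply: sumr_ge0 => i _.
rewrite -scalemxAr htZ mulr_ge0 ?pos_coef // leNgt; apply/negP => h.
by apply: hN; exists i.
Qed.

Lemma ninv_reduced w : weyl D w -> has_word_of_size D w (ninv w).
Proof.
move=> hw; move hk: (ninv w) => k; elim: k w hk hw => [|k IH] w hk hw.
  by exists [::] => //; rewrite word_nil; exact: weyl_ninv0.
have [i hi] : exists i, ht D set0 (w *m alpha i) < 0.
  by apply: ninv_descent_ex; rewrite ?hk.
have hr : weyl D (reflection (alpha i)).
  by apply: weyl_reflection; exact: simple_root_in.
have [||l sl el] := IH (w *m reflection (alpha i)).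
- by apply/eqP; rewrite -eqSS -ninv_descent // hk.
- exact: weylM.
exists (rcons l i); first by rewrite size_rcons sl.
by rewrite word_rcons -el -mulmxA reflection_sq ?alpha_nz // mulmx1.
Qed.

Lemma weyl_lengthE w : weyl D w -> weyl_length D w = ninv w.
Proof.
move=> hw; rewrite /weyl_length.
set P := (X in xget _ X).
have /(xgetPex 0%N)[/= h1 h2] : exists k, P k.
  exists (ninv w); split; first exact: ninv_reduced.
  by move=> m [l <- ->]; exact: ninv_word.
apply/eqP; rewrite eqn_leq; apply/andP; split.
  exact/h2/ninv_reduced.
by case: h1 => l <- ->; exact: ninv_word.
Qed.

End Weyl.

(** * Affine roots *)

Section Affine.
Variables (R : realType) (n : nat) (D : simpleRootSystem R n).
Implicit Types (J : {set 'I_n}) (w : 'M[R]_n) (a e v xi : 'cV[R]_n).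
Implicit Types (x y z u : affine R n) (b c g : affine_vector R n).

Local Notation alpha := (simple_root D).
Local Notation Phi := (Defs.roots D).
Local Notation qspan := (int_span (simple_coroot D)).
Local Notation Waf := (affine_weyl D).
Local Notation "x ** y" := (affine_mul x y) (at level 40, left associativity).
Local Notation refl := (@affine_reflection R n).
Local Notation act := (@affine_act R n).

Definition aroot b : Prop := b.1 \in Phi /\ b.2 \is a Num.int.

Definition ht_bound : R := 1 + \sum_(a <- Phi) `|ht D set0 a|.

(** Since [delta] outweighs all finite roots, one linear form decides the
    positivity of affine roots, and its integer values allow induction. *)
Definition aht b : R := ht_bound * b.2 + ht D set0 b.1.

Lemma ht_bound_gt a : a \in Phi -> `|ht D set0 a| < ht_bound.
Proof.
move=> aD; rewrite /ht_bound (bigD1_seq a) ?fset_uniq //=.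
by rewrite addrCA ltrDl ltr_pwDl // sumr_ge0.
Qed.

Lemma ht_bound_gt0 : 0 < ht_bound.
Proof. by rewrite ltr_pwDl // sumr_ge0. Qed.

Lemma ht_bound_int : ht_bound \is a Num.int.
Proof.
rewrite rpredD ?rpred1 // big_seq rpred_sum // => a aD.
by apply: intr_nat; rewrite natr_norm_int // ht_int.
Qed.

Lemma aht_int b : aroot b -> aht b \is a Num.int.
Proof. by case=> h1 h2; rewrite rpredD ?rpredM ?ht_bound_int ?ht_int. Qed.

Lemma aht_gt0 b : aroot b ->
  (0 < aht b) = ((ht D set0 b.1 < 0)%R%:R <= b.2).
Proof.
case: b => a k [/= aD /intrP[m ->]]; rewrite /aht /=.
have := ht_bound_gt aD; have hb := ht_bound_gt0.
have := ht0_neq0 aD; set t := ht _ _ a; set h := ht_bound in hb * => t0.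
rewrite ltr_norml => /andP[h1 h2].
case: (ltgtP m 0) => hm.
- have m1 : m%:~R <= (-1 : R) by rewrite -[-1]/((-1)%:~R) ler_int -ltzD1.
  transitivity false; last first.
    apply/esym/negbTE; rewrite -ltNge (le_lt_trans m1) //.
    by case: (t < 0) => /=; lra.
  by apply/negbTE; rewrite -leNgt; nra.
- have m1 : 1 <= m%:~R :> R by rewrite ler1z.
  by transitivity true; [nra|apply/esym; case: (t < 0) => /=; rewrite ?(le_trans _ m1)].
- by rewrite hm mulr0z mulr0 add0r; case: ltgtP t0 => //= _ _; rewrite ?ler10 ?lexx.
Qed.

Lemma aht_neg b : aht (- b.1, - b.2) = - aht b.
Proof. by rewrite /aht /= htN mulrN opprD. Qed.

Lemma aroot_opp b : aroot b -> aroot (- b.1, - b.2).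
Proof. by case=> h1 h2; split; rewrite /= ?rootN ?rpredN. Qed.

Lemma aht_neq0 b : aroot b -> aht b != 0.
Proof.
move=> hb; apply/negP => /eqP h0.
have := aht_gt0 (aroot_opp hb); rewrite aht_neg h0 oppr0 ltxx /=.
have := aht_gt0 hb; rewrite h0 ltxx.
have key (k : R) : k \is a Num.int -> 0 < k -> k < 1 -> False.
  by move=> kI /(int_ge1 kI) k1; rewrite ltNge k1.
case: hb => aD kI; rewrite htN oppr_lt0; have := ht0_neq0 aD.
case: ltgtP => //= _ _ /esym/negbT; rewrite -ltNge => h1 /esym/negbT.
  by rewrite -ltNge oppr_lt0 => h2; exact: key kI h2 h1.
by rewrite -ltNge => h2; apply: (key (- b.2)); rewrite ?rpredN ?oppr_gt0.
Qed.

Lemma aht_lt0 b : aroot b -> (aht b < 0) = (b.2 < (ht D set0 b.1 < 0)%R%:R).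
Proof.
by move=> hb; rewrite ltNge le_eqVlt eq_sym (negPf (aht_neq0 hb)) /= aht_gt0 // -ltNge.
Qed.

Lemma pos_affine_rootE b : pos_affine_root D b <-> aroot b /\ 0 < aht b.
Proof.
rewrite /pos_affine_root pos_rootsE; split.
  move=> [bD h]; have hb : aroot b.
    by split=> //; case: h => [[_ ->]|[]//]; rewrite rpred0.
  split=> //; rewrite aht_gt0 //; case: h => [[/andP[_ h1] ->]|[h1 h2]].
    by rewrite ltNge (ltW h1) /= lexx.
  by case: (_ < 0) => /=; [exact: int_ge1|exact: ltW].
move=> [hb]; rewrite aht_gt0 //; case: hb => bD bI h; split=> //.
move: h; rewrite bD /=; have := ht0_neq0 bD; case: ltgtP => //= _ _ h.
  by right; split=> //; exact: lt_le_trans h.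
by move: h; rewrite le_eqVlt => /orP[/eqP <-|h]; [left|right].
Qed.

(** * The affine Weyl group *)

Definition aone : affine R n := (1%:M, 0).

Definition ainv x : affine R n := (x.1^T, - (x.1 *m x.2)).

Lemma amulE x y : Waf y -> x ** y = (x.1 *m y.1, y.1^T *m x.2 + y.2).
Proof. by move=> [hy _]; rewrite /affine_mul (weyl_invmx hy). Qed.

Lemma parabolic_affine J x : affine_weyl_parabolic D J x -> Waf x.
Proof. by move=> [h1 h2]; split; [exact: parabolic_weyl h1|exact: qspanT h2]. Qed.

Lemma aparabolic1 J : affine_weyl_parabolic D J aone.
Proof. by split; [exact: parabolic1|exact: qspan0]. Qed.

Lemma aparabolicM J x y : affine_weyl_parabolic D J x ->
  affine_weyl_parabolic D J y -> affine_weyl_parabolic D J (x ** y).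
Proof.
move=> hx hy; rewrite (amulE _ (parabolic_affine hy)).
case: hx hy => h1 h2 [h3 h4]; split; first exact: parabolicM.
by apply: qspanD => //; apply: qspan_parabolic => //; exact: parabolicV.
Qed.

Lemma aparabolicV J x : affine_weyl_parabolic D J x ->
  affine_weyl_parabolic D J (ainv x).
Proof.
case=> h1 h2; split; first exact: parabolicV.
by apply: qspanN; apply: qspan_parabolic.
Qed.

Lemma Waf1 : Waf aone. Proof. exact: (aparabolic1 [set: 'I_n]). Qed.
Lemma WafM x y : Waf x -> Waf y -> Waf (x ** y). Proof. exact: aparabolicM. Qed.
Lemma WafV x : Waf x -> Waf (ainv x). Proof. exact: aparabolicV. Qed.

Lemma amulA x y z : Waf y -> Waf z -> x ** (y ** z) = x ** y ** z.
Proof.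
move=> hy hz; rewrite (amulE x (WafM hy hz)) !(amulE _ hz) (amulE _ hy) /=.
by rewrite trmx_mul mulmxDr !mulmxA addrA.
Qed.

Lemma amul1 x : x ** aone = x.
Proof.
by rewrite (amulE _ Waf1) /= mulmx1 trmx1 mul1mx addr0; case: x.
Qed.

Lemma a1mul x : Waf x -> aone ** x = x.
Proof. by move=> hx; rewrite (amulE _ hx) /= mul1mx mulmx0 add0r; case: (x). Qed.

Lemma amulV x : Waf x -> x ** ainv x = aone.
Proof.
move=> hx; rewrite (amulE _ (WafV hx)) /= (weyl_Ktr (proj1 hx)).
by rewrite trmxK subrr.
Qed.

Lemma aVmul x : Waf x -> ainv x ** x = aone.
Proof.
move=> hx; have hw : weyl D x.1 by case: hx.
by rewrite (amulE _ hx) /= (weyl_trK hw) mulmxN (weyl_mulKmx _ hw) addNr.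
Qed.

Lemma amulKV x y : Waf x -> Waf y -> x ** y ** ainv y = x.
Proof. by move=> hx hy; rewrite -amulA ?amulV ?amul1 //; exact: WafV. Qed.

Lemma amulVK x y : Waf x -> Waf y -> x ** ainv y ** y = x.
Proof. by move=> hx hy; rewrite -amulA ?aVmul ?amul1 //; exact: WafV. Qed.

Lemma actM x y b : Waf y -> act (x ** y) b = act x (act y b).
Proof.
move=> hy; rewrite (amulE _ hy) /affine_act /= -mulmxA; congr (_, _).
by rewrite dotDl dot_mulmx trmxK opprD addrA addrAC.
Qed.

Lemma act1 b : act aone b = b.
Proof. by case: b => a k; rewrite /affine_act /= mul1mx dot0l subr0. Qed.

Lemma actKV x b : Waf x -> act x (act (ainv x) b) = b.
Proof. by move=> hx; rewrite -actM ?amulV ?act1 //; exact: WafV. Qed.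

Lemma aroot_act x b : Waf x -> aroot b -> aroot (act x b).
Proof.
move=> [h1 h2] [h3 h4]; split=> /=; first by rewrite weyl_root.
by rewrite rpredB // (dot_qspan h2).
Qed.

Lemma Waf_refl b : aroot b -> Waf (refl b).
Proof.
move=> [h1 h2]; split; first exact: weyl_reflection.
by apply: qspanZ => //; exact: qspan_coroot.
Qed.

Lemma aparabolic_refl J b : aroot b -> ht D J b.1 = 0 ->
  affine_weyl_parabolic D J (refl b).
Proof.
move=> [h1 h2] h3; have [h4 h5] := reflection_parabolic h1 h3.
by split=> //; apply: qspanZ.
Qed.

Lemma act_refl b c : act (refl b) c =
  (c.1 - dot (coroot b.1) c.1 *: b.1, c.2 - dot (coroot b.1) c.1 * b.2).
Proof. by rewrite /affine_act /= reflectionE dotZl mulrC. Qed.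

Lemma aht_act_refl x b c : aht (act x (act (refl b) c)) =
  aht (act x c) - dot (coroot b.1) c.1 * aht (act x b).
Proof.
rewrite act_refl /aht /affine_act /= mulmxBr -scalemxAr htD htN htZ.
by rewrite dotBr dotZr; ring.
Qed.

Lemma aht_refl b c : aht (act (refl b) c) =
  aht c - dot (coroot b.1) c.1 * aht b.
Proof. by have := aht_act_refl aone b c; rewrite !act1. Qed.

Lemma act_refl_self b : aroot b -> act (refl b) b = (- b.1, - b.2).
Proof.
move=> [hb _]; rewrite act_refl dot_coroot_self; last exact: root_nz hb.
congr (_, _); last by ring.
by rewrite scaler_nat mulr2n opprD addrA subrr sub0r.
Qed.

Lemma refl_conj x b : Waf x -> aroot b ->
  refl (act x b) ** x = x ** refl b.
Proof.
move=> hx hb; have hw : weyl D x.1 by case: hx.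
rewrite (amulE _ hx) (amulE _ (Waf_refl hb)) /= (reflection_weyl _ hw); congr (_, _).
rewrite (coroot_weyl _ hw) -scalemxAr (weyl_mulKmx _ hw) tr_reflection reflectionE.
by rewrite dot_coroot_swap scalerBl (dotC b.1) addrC [RHS]addrAC -addrA.
Qed.

Lemma refl_sq b : aroot b -> refl b ** refl b = aone.
Proof.
move=> hb; rewrite (amulE _ (Waf_refl hb)) /= reflection_sq; last first.
  by case: hb => /root_nz.
rewrite tr_reflection /aone -scalemxAr; congr (_, _); case: hb => bD _.
rewrite -(coroot_weyl _ (weyl_reflection bD)) reflection_self ?(root_nz bD) //.
by rewrite corootN scalerN addNr.
Qed.

Lemma reflK b x : aroot b -> Waf x -> refl b ** (refl b ** x) = x.
Proof.
by move=> hb hx; rewrite amulA ?refl_sq ?a1mul //; exact: Waf_refl.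
Qed.

Lemma reflKr b x : aroot b -> Waf x -> x ** refl b ** refl b = x.
Proof.
by move=> hb hx; rewrite -amulA ?refl_sq ?amul1 //; exact: Waf_refl.
Qed.

Lemma refl_opp b : refl (- b.1, - b.2) = refl b.
Proof. by rewrite /affine_reflection /= reflectionN corootN scalerN scaleNr opprK. Qed.

(** * Counting the negative roots of a string *)

(** The affine root [e + k delta] is sent by [z] to a negative one exactly when
    [k < cnt z e].  For a positive root [e] this is thus the signed number of
    hyperplanes in direction [e] between the base alcove and its image under
    the inverse of [z]. *)
Definition cnt z e : R := dot z.2 e + (ht D set0 (z.1 *m e) < 0)%R%:R.

Lemma cnt_int z e : Waf z -> e \in Phi -> cnt z e \is a Num.int.
Proof. by move=> [_ h] eD; rewrite rpredD ?rpred_nat // (dot_qspan h). Qed.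

Lemma aht_act_lt0 z e (k : R) : Waf z -> e \in Phi -> k \is a Num.int ->
  (aht (act z (e, k)) < 0) = (k < cnt z e).
Proof.
move=> hz eD kI; rewrite aht_lt0; last exact: aroot_act.
by rewrite /= ltrBlDl.
Qed.

Lemma aht_act_gt0 z e (k : R) : Waf z -> e \in Phi -> k \is a Num.int ->
  (0 < aht (act z (e, k))) = (cnt z e <= k).
Proof.
move=> hz eD kI; rewrite leNgt -aht_act_lt0 // -leNgt le_eqVlt eq_sym.
by rewrite (negPf (aht_neq0 _)) //; exact: aroot_act.
Qed.

Lemma cntN z e : Waf z -> e \in Phi -> cnt z (- e) = 1 - cnt z e.
Proof.
move=> [hw _] eD; rewrite /cnt dotNr mulmxN htN oppr_lt0.
have : z.1 *m e \in Phi by rewrite weyl_root.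
by move/ht0_neq0; case: ltgtP => //= _ _; ring.
Qed.

Lemma cntM z u e : Waf u -> cnt (z ** u) e = cnt z (u.1 *m e) + dot u.2 e.
Proof.
move=> hu; rewrite (amulE _ hu) /cnt /= dotDl dot_mulmx trmxK mulmxA.
by rewrite addrAC.
Qed.

Lemma cnt1 e : 0 < ht D set0 e -> cnt aone e = 0.
Proof. by move=> h; rewrite /cnt /= dot0l mul1mx ltNge ltW // add0r. Qed.

Lemma ltr_int1 (k m : R) : k \is a Num.int -> m \is a Num.int ->
  (k < m + 1) = (k <= m).
Proof.
move=> /intrP[i ->] /intrP[j ->].
by rewrite -[1]/(1%:~R) -intrD ltr_int ler_int ltzD1.
Qed.

Lemma lt_intP (c c' : R) : c \is a Num.int -> c' \is a Num.int ->
  (forall k, k \is a Num.int -> (k < c) -> (k < c')) -> c <= c'.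
Proof.
move=> hc hc' h; have k1 : c - 1 \is a Num.int by rewrite rpredB ?rpred1.
have := h _ k1; rewrite ltrBlDr ltrDl ltr01 => /(_ isT).
by rewrite ltrBlDr ltr_int1.
Qed.

Lemma eq_intP (c c' : R) : c \is a Num.int -> c' \is a Num.int ->
  (forall k, k \is a Num.int -> (k < c) = (k < c')) -> c = c'.
Proof.
move=> hc hc' h; apply/eqP; rewrite eq_le; apply/andP.
by split; apply: lt_intP => // k kI; rewrite h.
Qed.

(** * Elements that preserve positivity *)

Lemma qspan_roots J xi : qspan J xi -> exists2 l : seq 'cV[R]_n,
  forall a, a \in l -> a \in Phi /\ ht D J a = 0 & xi = \sum_(a <- l) coroot a.
Proof.
pose Q (v : 'cV[R]_n) := exists2 l : seq 'cV[R]_n,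
  forall a, a \in l -> a \in Phi /\ ht D J a = 0 & v = \sum_(a <- l) coroot a.
have add v v' : Q v -> Q v' -> Q (v + v').
  move=> [l hl ->] [l' hl' ->]; exists (l ++ l'); last by rewrite big_cat.
  by move=> a; rewrite mem_cat => /orP[/hl|/hl'].
move=> [c ->]; rewrite -/(Q _); elim/big_ind: _ => [|//|j jJ].
  by exists [::] => //; rewrite big_nil.
have aj : alpha j \in Phi /\ ht D J (alpha j) = 0.
  by rewrite simple_root_in ht_alpha jJ.
have aj' : - alpha j \in Phi /\ ht D J (- alpha j) = 0.
  by rewrite rootN ?htN ?aj.2 ?oppr0 ?simple_root_in.
have rep a m : a \in Phi /\ ht D J a = 0 -> Q (m%:R *: coroot a).
  move=> ha; exists (nseq m a); first by move=> b /nseqP[-> _].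
  rewrite big_nseq; elim: m => [|m IH]; first by rewrite scale0r.
  by rewrite iterS -IH -natr1 addrC scalerDl scale1r.
case: (c j) => m; first exact: rep.
have [l hl e] := rep _ m.+1 aj'; exists l => //.
by rewrite -e corootN scalerN NegzE intrN scaleNr.
Qed.

(** There is no nonzero minuscule coweight in the coroot lattice.  Write [xi] as
    a sum of coroots; some summand [coroot a] pairs positively with [xi], hence
    to 1, and then the reflection in [a] removes it from the sum.  The
    result satisfies the same bounds and is a shorter sum. *)
Lemma minuscule_eq0 J xi : qspan J xi ->
  (forall a, a \in Phi -> ht D J a = 0 -> dot xi a <= 1) -> xi = 0.
Proof.
move=> hxi; have [l] := qspan_roots hxi.
have [k] := ubnP (size l); elim: k l xi hxi => // k IH l xi hxi hk hl exi h.
have [//|xi0] := eqVneq xi 0.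
have [a al da] : exists2 a, a \in l & 0 < dot xi a.
  apply: contrapT => hN; have := dot_gt0 xi; rewrite xi0 {2}exi dot_sumr.
  rewrite ltNge => /negP; apply; rewrite big_seq; apply: sumr_le0 => a al.
  rewrite leNgt; apply/negP; have [aD _] := hl _ al.
  rewrite dotC dot_coroot_gt0 ?(root_nz aD) // dotC => h'.
  by apply: hN; exists a.
have [aD ha] := hl _ al.
have d1 : dot xi a = 1.
  by apply/eqP; rewrite eq_le h //= int_ge1 // (dot_qspan (qspanT hxi)).
have [ra ca] := reflection_parabolic aD ha.
have rxi : reflection a *m xi = xi - coroot a.
  by rewrite reflectionE dot_coroot_swap dotC d1 scale1r.
suff : reflection a *m xi = 0.
  move=> e0; rewrite -[xi](@reflectionK _ _ a) ?(root_nz aD) //.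
  by rewrite e0 mulmx0.
apply: (IH (rem a l)).
- exact: qspan_parabolic.
- rewrite -ltnS (leq_trans _ hk) // ltnS size_rem // prednK //.
  by rewrite -has_predT; apply/hasP; exists a.
- by move=> b /mem_rem/hl.
- by rewrite rxi exi (big_rem a) //= addrAC subrr add0r.
move=> b bD hb; rewrite dot_reflection; apply: h.
  by rewrite root_reflection.
by rewrite ht_parabolic.
Qed.

(** If [u] inverts no positive affine root along [J], then the pairings of its
    translation part with the roots of [J] are 0, 1 or -1.  So this part is zero,
    and the finite part has no inversions. *)
Lemma aparabolic_cnt0 J u : affine_weyl_parabolic D J u ->
  (forall e, e \in Phi -> ht D J e = 0 -> 0 < ht D set0 e -> cnt u e = 0) ->
  u = aone.
Proof.
move=> hu h; have hW := parabolic_affine hu; case: hu => hw hxi.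
have e2 : u.2 = 0.
  apply: (minuscule_eq0 hxi) => a aD ha; have := ht0_neq0 aD.
  rewrite neq_lt => /orP[na|pa].
    have := @h (- a); rewrite rootN // !htN ha oppr0 oppr_gt0 na.
    rewrite cntN // => /(_ isT erefl isT)/eqP; rewrite subr_eq0 => /eqP; rewrite /cnt.
    by case: (_ < 0) => /=; lra.
  by have := h _ aD ha pa; rewrite /cnt; case: (_ < 0) => /=; lra.
rewrite [u]surjective_pairing e2; congr (_, _).
apply: (weyl_ninv0 (parabolic_weyl hw)).
rewrite /ninv big_seq_cond big1 // => e /andP[eD pe]; apply/eqP; rewrite eqb0.
have := ht_geW J eD pe; rewrite le_eqVlt => /orP[/eqP h0|hp].
  have := h _ eD (esym h0) pe; rewrite /cnt e2 dot0l add0r.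
  by case: (_ < 0) => // /eqP; rewrite oner_eq0.
rewrite -leNgt ltW // (@ht_gt0W _ _ _ J) ?weyl_root ?ht_parabolic //.
exact: parabolic_weyl hw.
Qed.

(** * Simple affine roots *)

(** These are the [alpha i] and [- theta + delta] with [theta] the highest root,
    but characterised by what is needed of them: the reflection permutes the
    other positive affine roots. *)
Definition asimple b : Prop := [/\ aroot b, 0 < aht b &
  forall c, aroot c -> 0 < aht c -> c <> b -> 0 < aht (act (refl b) c)].

Lemma pairing_cases (p q : int) : 0 < p -> 0 < q -> p * q < 4 -> p != 1 ->
  q = 1 /\ (p = 2 \/ p = 3).
Proof.
move=> p0 q0 pq p1; have p2 : (2 <= p)%R by lia.
have q1 : (q < 2)%R by nia.
have eq1 : q = 1 by lia.
by split=> //; rewrite eq1 mulr1 in pq; lia.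
Qed.

(** By minimality [b] is not a sum of two positive affine roots, nor of one and a
    positive multiple of [delta].  If its reflection made another positive root
    [c] negative, then the [b]-string from [c] to its reflection would consist
    of roots, and the place where the string turns negative would give such a
    decomposition of [b]. *)
Lemma min_inversion_simple u b : Waf u -> aroot b -> 0 < aht b ->
  aht (act u b) < 0 ->
  (forall c, aroot c -> 0 < aht c -> aht c < aht b -> ~ aht (act u c) < 0) ->
  asimple b.
Proof.
move=> hu hb pb nb hmin; split=> // c hc pc cb.
have nodec b1 b2 : aroot b1 -> aroot b2 -> 0 < aht b1 -> 0 < aht b2 ->
    b.1 = b1.1 + b2.1 -> b.2 = b1.2 + b2.2 -> False.
  move=> h1 h2 p1 p2 e1 e2.
  have e : aht b = aht b1 + aht b2 by rewrite /aht e1 e2 htD; ring.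
  have e' : aht (act u b) = aht (act u b1) + aht (act u b2).
    by rewrite /aht /= e1 e2 mulmxDr !htD dotDr; ring.
  have [n1|n1] := ltP (aht (act u b1)) 0.
    by apply: (hmin b1) => //; rewrite e ltrDl.
  have [n2|n2] := ltP (aht (act u b2)) 0.
    by apply: (hmin b2) => //; rewrite e ltrDr.
  by move: nb; rewrite e' ltNge addr_ge0.
have hrc : aroot (act (refl b) c) by apply: aroot_act => //; exact: Waf_refl.
have := aht_neq0 hrc; rewrite neq_lt => /orP[nr|//]; exfalso.
have [bD bI] := hb; have [cD cI] := hc.
have b0 := root_nz bD; have c0 := root_nz cD.
have nr' := nr; rewrite aht_refl in nr'.
have hopp := aroot_opp hrc.
have popp : 0 < aht (- (act (refl b) c).1, - (act (refl b) c).2).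
  by rewrite aht_neg oppr_gt0.
rewrite act_refl /= in hopp popp.
have := pairing_int bD cD; have := pairing_int cD bD.
have pq : dot (coroot b.1) c.1 * dot (coroot c.1) b.1 < 4 \/
    c.1 = (dot (coroot b.1) c.1 / 2) *: b.1.
  have [e|ne] := eqVneq c.1 ((dot (coroot b.1) c.1 / 2) *: b.1); first by right.
  by left; apply: coroot_pairing_lt4.
have swap : (0 < dot (coroot c.1) b.1) = (0 < dot (coroot b.1) c.1).
  by rewrite !dot_coroot_gt0 // dotC.
have shift k : aht (b.1, k) = aht b - ht_bound * (b.2 - k).
  by rewrite /aht /=; ring.
have ushift k : aht (act u (b.1, k)) = aht (act u b) - ht_bound * (b.2 - k).
  by rewrite /aht /=; ring.
have hbd := ht_bound_gt0.
have nodelta k : k \is a Num.int -> k < b.2 -> 0 < aht (b.1, k) -> False.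
  move=> kI kb pk.
  have hk : 0 < ht_bound * (b.2 - k) by rewrite mulr_gt0 // subr_gt0.
  have kr : aroot (b.1, k) by split.
  have e1 : aht (b.1, k) < aht b by rewrite shift ltrBlDr ltrDl.
  apply: (hmin _ kr pk e1); rewrite ushift.
  by rewrite subr_lt0 (lt_trans nb).
set p := dot (coroot b.1) c.1 in nr' hopp popp pq swap *.
set q := dot (coroot c.1) b.1 in pq swap *.
move=> /intrP[q' eq'] /intrP[p' ep'].
have p0 : 0 < p.
  rewrite ltNge; apply/negP => p0.
  by have := mulr_le0_ge0 p0 (ltW pb); lra.
have q0 : 0 < q by rewrite swap.
case: pq => [pq|prop]; last first.
  have cD' := cD; rewrite prop in cD'.
  have [c1|c1] := root_reduced bD cD'; last by lra.
  have ec : c.1 = b.1 by rewrite prop c1 scale1r.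
  have p2 : p = 2 by lra.
  case: (ltgtP c.2 b.2) => hcb.
  - by apply: (nodelta c.2) => //; rewrite -ec -surjective_pairing.
  - apply: (nodelta (2 * b.2 - c.2)); first by rewrite rpredB ?rpredM ?rpred_nat.
      by lra.
    move: popp; rewrite p2 ec opprB [2 *: _]scaler_nat mulr2n addrK.
    by rewrite opprB.
  - by apply: cb; rewrite [c]surjective_pairing ec hcb -surjective_pairing.
have [p'0 q'0] : (0 < p')%R /\ (0 < q')%R by rewrite -!(ltr0z R) -ep' -eq'.
have pq' : (p' * q' < 4)%R by rewrite -(ltr_int R) intrM -ep' -eq'.
have [p1|p1] := eqVneq p' 1.
  move: hopp popp; rewrite ep' p1 scale1r mul1r => h1 h2.
  apply: (nodec c _ hc h1 pc h2) => /=; first by rewrite opprB addrC subrK.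
  by ring.
have [q1 p23] := pairing_cases p'0 q'0 pq' p1.
have hg1 : aroot (c.1 - b.1, c.2 - b.2).
  split; rewrite /= ?rpredB // -opprB rootNE -[b.1 - c.1]/(_ - _).
  have := root_reflection cD bD; rewrite reflectionE -/q eq' q1 scale1r.
  by [].
have [n1|p1'] := ltP (aht (c.1 - b.1, c.2 - b.2)) 0.
  have h1 := aroot_opp hg1; have h2 := aht_neg (c.1 - b.1, c.2 - b.2).
  apply: (nodec c _ hc h1 pc) => /=; first by rewrite h2 oppr_gt0.
    by rewrite opprB addrC subrK.
  by ring.
have {p1'}p1' : 0 < aht (c.1 - b.1, c.2 - b.2) by rewrite lt_def aht_neq0.
case: p23 => e2.
  move: hopp popp; rewrite ep' e2 => h1 h2.
  apply: (nodec _ _ hg1 h1 p1' h2) => /=; last by ring.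
  rewrite -[2%:~R]/(2%:R) scaler_nat mulr2n.
  by rewrite opprB addrC addrA subrK addrK.
have hg2 : aroot (c.1 - b.1 - b.1, c.2 - b.2 - b.2).
  have := aroot_act (Waf_refl hb) hg1; rewrite act_refl /= dotBr.
  rewrite dot_coroot_self // -/p ep' e2 -[3%:~R]/(3%:R).
  by rewrite (_ : 3%:R - 2 = 1 :> R) ?scale1r ?mul1r //; ring.
have [n2|p2'] := ltP (aht (c.1 - b.1 - b.1, c.2 - b.2 - b.2)) 0.
  have h1 := aroot_opp hg2; have h2 := aht_neg (c.1 - b.1 - b.1, c.2 - b.2 - b.2).
  apply: (nodec _ _ hg1 h1 p1') => /=; first by rewrite h2 oppr_gt0.
    by rewrite opprB addrC subrK.
  by ring.
have {p2'}p2' : 0 < aht (c.1 - b.1 - b.1, c.2 - b.2 - b.2).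
  by rewrite lt_def aht_neq0.
move: hopp popp; rewrite ep' e2 -[3%:~R]/(3%:R) => h1 h2.
apply: (nodec _ _ hg2 h1 p2' h2) => /=; last by ring.
by rewrite scaler_nat mulrS mulr2n opprB addrC !addrA !subrK addrAC subrr add0r.
Qed.

Lemma inversion_simple u : Waf u -> u <> aone ->
  exists2 b, asimple b & aht (act u b) < 0.
Proof.
move=> hu u1; have [b [hb pb nb]] : exists b, [/\ aroot b, 0 < aht b & aht (act u b) < 0].
  apply: contrapT => hN; apply: u1.
  apply: (@aparabolic_cnt0 [set: 'I_n]) => // e eD _ pe.
  apply/eqP; rewrite eq_le; apply/andP; split.
    rewrite leNgt -aht_act_lt0 ?rpred0 //; apply/negP => h; apply: hN.
    exists (e, 0); split=> //; first by split; rewrite //= rpred0.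
    by rewrite /aht /= mulr0 add0r.
  rewrite leNgt; apply/negP => h; apply: hN; exists (- e, 1).
  have h1 : aroot (- e, 1) by split; rewrite /= ?rootN ?rpred1.
  split=> //; first by rewrite aht_gt0 //=; case: (_ < 0) => /=; rewrite ?ler01.
  by rewrite aht_act_lt0 ?rpred1 ?rootN // cntN //; lra.
have [m hm] : exists m : nat, aht b = m%:R.
  have /intrP[[m|m] h] := aht_int hb; first by exists m.
  by rewrite h ltr0z in pb.
elim/ltn_ind: m b hb pb nb hm => m IH b hb pb nb hm.
have [h|hN] := pselect (exists c,
  [/\ aroot c, 0 < aht c, aht c < aht b & aht (act u c) < 0]).
  have [c [hc pc cb nc]] := h.
  have [k hk] : exists k : nat, aht c = k%:R.
    have /intrP[[k|k] hk] := aht_int hc; first by exists k.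
    by rewrite hk ltr0z in pc.
  by apply: (IH k _ c) => //; rewrite -(ltr_nat R) -hk -hm.
exists b => //; apply: min_inversion_simple nb _ => // c hc pc cb nc.
by apply: hN; exists c.
Qed.

End Affine.

(** * Lengths relative to a parabolic *)

Section Length.
Variables (R : realType) (n : nat) (D : simpleRootSystem R n).
Implicit Types (J : {set 'I_n}) (w : 'M[R]_n) (a e v xi : 'cV[R]_n).
Implicit Types (x y z u : affine R n) (b c g : affine_vector R n).

Local Notation alpha := (simple_root D).
Local Notation Phi := (Defs.roots D).
Local Notation Waf := (affine_weyl D).
Local Notation "x ** y" := (affine_mul x y) (at level 40, left associativity).
Local Notation refl := (@affine_reflection R n).
Local Notation act := (@affine_act R n).
Local Notation ht := (ht D).
Local Notation aht := (aht D).
Local Notation cnt := (cnt D).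
Local Notation aroot := (aroot D).
Local Notation asimple := (asimple D).

Lemma sum_root_gt0 (P : pred 'cV[R]_n) (F : 'cV[R]_n -> R) a :
  (forall e, e \in Phi -> P e -> 0 <= F e) -> a \in Phi -> P a -> 0 < F a ->
  0 < \sum_(e <- Phi | P e) F e.
Proof.
move=> h aD Pa Fa; rewrite big_mkcond (bigD1_seq a) ?fset_uniq //= Pa.
rewrite ltr_pwDl // big_seq_cond; apply: sumr_ge0 => e /andP[eD _].
by case: ifP => // Pe; exact: h.
Qed.

Lemma sum_reflection_split (P : pred 'cV[R]_n) (F : 'cV[R]_n -> R) a :
  a \in Phi -> let r := reflection a in
  \sum_(e <- Phi | P e) (F (r *m e) - F e) =
  \sum_(e <- Phi | P e && ~~ P (r *m e)) (F (r *m e) - F e).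
Proof.
move=> aD r; rewrite (bigID (fun e => P (r *m e))) /= sumrB.
have rr e : r *m (r *m e) = e by rewrite reflectionK ?(root_nz aD).
rewrite -(sum_weyl_cond (fun e => P e && P (r *m e)) F (weyl_reflection aD)).
rewrite -/r; under [X in _ - X]eq_bigl do rewrite rr andbC.
by rewrite subrr add0r.
Qed.

Lemma ht_reflection J a v :
  ht J (reflection a *m v) = ht J v - dot (coroot a) v * ht J a.
Proof. by rewrite reflectionE htD htN htZ. Qed.

Lemma exits_pairing J a e : a \in Phi -> 0 <= ht J a -> 0 < ht J e ->
  ~~ (0 < ht J (reflection a *m e)) -> 0 < dot (coroot a) e.
Proof.
move=> aD ha he; rewrite ht_reflection -leNgt => h; rewrite ltNge.
apply/negP => h'; have := mulr_le0_ge0 h' ha; lra.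
Qed.

(** The roots [e] whose reflection in [a] is again positive off [J] cancel in
    pairs; all the others pair positively with [a], among them [a] itself. *)
Lemma sum_pairing_gt0 J (f : 'cV[R]_n -> R) a : a \in Phi -> 0 < ht J a ->
  (forall e, e \in Phi -> 0 < f e) ->
  (forall e, e \in Phi -> f (reflection a *m e) = f e) ->
  0 < \sum_(e <- Phi | 0 < ht J e) f e * dot a e.
Proof.
move=> aD ha f0 fr; have a0 := root_nz aD; set r := reflection a in fr *.
have dr e : dot a (r *m e) = - dot a e.
  by rewrite -dot_reflection reflection_self // dotNl.
have := sum_reflection_split (fun e => 0 < ht J e) (fun e => f e * dot a e) aD.
rewrite -/r /= => split.
rewrite -oppr_lt0 -(pmulr_rlt0 _ (ltr0n R 2)) mulrN -oppr_gt0 opprK.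
have e1 (P : pred 'cV[R]_n) : \sum_(e <- Phi | P e)
    (f (r *m e) * dot a (r *m e) - f e * dot a e) =
    - (2 * \sum_(e <- Phi | P e) f e * dot a e).
  rewrite big_distrr -sumrN /= big_seq_cond [RHS]big_seq_cond.
  by apply: eq_bigr => e /andP[eD _]; rewrite fr // dr; ring.
move: split; rewrite !e1 => /oppr_inj ->; rewrite pmulr_rgt0 //.
have pos e : 0 < ht J e -> ~~ (0 < ht J (r *m e)) -> 0 < dot a e.
  by move=> h1 h2; rewrite -(dot_coroot_gt0 _ a0); exact: exits_pairing (ltW ha) _ _.
apply: (sum_root_gt0 _ aD) => [e eD /andP[h1 h2]||].
- by rewrite ltW // mulr_gt0 ?f0 // pos.
- by rewrite ha /r reflection_self // htN oppr_gt0 -leNgt ltW.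
- by rewrite mulr_gt0 ?f0 // dot_gt0.
Qed.

Lemma sum_pairing_eq0 J (f : 'cV[R]_n -> R) a : a \in Phi -> ht J a = 0 ->
  (forall e, e \in Phi -> f (reflection a *m e) = f e) ->
  \sum_(e <- Phi | 0 < ht J e) f e * dot a e = 0.
Proof.
move=> aD ha fr; set S := \sum_(e <- _ | _) _.
suff : S = - S by lra.
rewrite {1}/S -(sum_weyl_cond _ _ (weyl_reflection aD)) -sumrN.
rewrite big_seq_cond [RHS]big_seq_cond.
apply: eq_big => [e|e /andP[eD _]].
  by rewrite ht_reflection ha mulr0 subr0.
by rewrite fr // -dot_reflection reflection_self ?(root_nz aD) // dotNl mulrN.
Qed.

(** On minimal coset representatives this is the semi-infinite length; in
    general it is the semi-infinite length of the representative of the coset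
    modulo the parabolic [J]. *)
Definition slen J z : R := \sum_(e <- Phi | 0 < ht J e) cnt z e.

Lemma slen_int J z : Waf z -> slen J z \is a Num.int.
Proof.
by move=> hz; rewrite /slen big_seq_cond rpred_sum // => e /andP[eD _]; exact: cnt_int.
Qed.

Lemma slen_translate J z u : Waf u -> slen J (z ** u) =
  \sum_(e <- Phi | 0 < ht J e) cnt z (u.1 *m e) +
  dot u.2 (\sum_(e <- Phi | 0 < ht J e) e).
Proof.
by move=> hu; rewrite dot_sumr -big_split; apply: eq_bigr => e _; exact: cntM.
Qed.

Lemma slen_parabolic J z u : affine_weyl_parabolic D J u ->
  slen J (z ** u) = slen J z.
Proof.
move=> hu; rewrite slen_translate; last exact: parabolic_affine hu.
case: hu => hw [k ->]; rewrite dot_suml [X in _ + X]big1 => [|j jJ]; last first.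
  rewrite dotZl /simple_coroot /coroot dotZl dot_sumr.
  have aD := simple_root_in D j.
  have := @sum_pairing_eq0 J (fun=> 1) _ aD; rewrite ht_alpha jJ.
  under eq_bigr do rewrite mul1r.
  by move=> ->; rewrite ?mulr0.
rewrite addr0.
rewrite /slen.
rewrite -(sum_weyl_cond (fun e => 0 < ht J e) (cnt z) (parabolic_weyl hw)).
by apply: eq_bigl => e; rewrite (ht_parabolic _ hw).
Qed.

(** The sign rule.  In the difference of the two lengths, the roots whose images
    under the reflection stay positive off [J] cancel in pairs.  On the
    others the count can only grow, as [z] keeps [g] positive, and on the
    direction of [g] itself it does. *)
Lemma slen_refl J z g : Waf z -> aroot g -> 0 < ht J g.1 ->
  0 < aht (act z g) -> slen J z < slen J (z ** refl g).
Proof.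
move=> hz hg hgJ pg; have [gD gI] := hg; have g0 := root_nz gD.
have hr := Waf_refl hg; have hzr := WafM hz hr.
set r := reflection g.1.
pose F e := cnt z e - g.2 / 2 * dot (coroot g.1) e.
have dr e : dot (coroot g.1) (r *m e) = - dot (coroot g.1) e.
  rewrite -dot_reflection -(coroot_weyl _ (weyl_reflection gD)).
  by rewrite reflection_self // corootN dotNl.
have eF e : F (r *m e) - F e = cnt (z ** refl g) e - cnt z e.
  by rewrite (cntM _ _ hr) /F dr /= dotZl -/r; field.
rewrite -subr_gt0 /slen -sumrB; under eq_bigr do rewrite -eF.
rewrite (sum_reflection_split (fun e => 0 < ht J e) F gD) /= -/r.
under eq_bigr do rewrite eF.
apply: (sum_root_gt0 _ gD) => [e eD /andP[h1 h2]||].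
- rewrite subr_ge0; apply: lt_intP => [||k kI]; try exact: cnt_int.
  rewrite -!(@aht_act_lt0 _ _ D) // (actM _ _ hr) aht_act_refl => hk.
  have := exits_pairing gD (ltW hgJ) h1 h2 => hp.
  by rewrite subr_lt0 (lt_trans hk) // mulr_gt0.
- by rewrite hgJ /r reflection_self // htN oppr_gt0 -leNgt ltW.
rewrite (cntM _ _ hr) /= reflection_self // cntN // dotZl dot_coroot_self //.
have : cnt z g.1 <= g.2 by rewrite -(@aht_act_gt0 _ _ D) // -surjective_pairing.
by lra.
Qed.

Lemma slen_refl_lt J z g : Waf z -> aroot g -> 0 < ht J g.1 ->
  (slen J z < slen J (z ** refl g)) = (0 < aht (act z g)).
Proof.
move=> hz hg hgJ; apply/idP/idP => h; last exact: slen_refl.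
have hzg := aroot_act hz hg; have hr := Waf_refl hg.
rewrite lt_def aht_neq0 // leNgt; apply/negP => ng.
have := @slen_refl J (z ** refl g) g (WafM hz hr) hg hgJ.
rewrite (actM _ _ hr) (act_refl_self hg) (reflKr hg hz).
have -> : aht (act z (- g.1, - g.2)) = - aht (act z g).
  by rewrite -aht_neg /affine_act /= mulmxN dotNr opprB opprK addrC.
by rewrite oppr_gt0 ng => /(_ isT); rewrite ltNge ltW.
Qed.

Lemma semi_infinite_lengthE z : Waf z ->
  semi_infinite_length D z = slen set0 z.
Proof.
move=> [hw _]; rewrite /semi_infinite_length (weyl_lengthE hw) /slen big_split /=.
rewrite addrC; congr (_ + _); first by rewrite /ninv natr_sum.
rewrite /rho dotZr mulrA divff ?pnatr_eq0 // mul1r -dot_sumr; congr (dot _ _).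
rewrite -[RHS]big_filter; apply: perm_big.
apply: uniq_perm; rewrite ?filter_uniq ?fset_uniq // => e.
by rewrite pos_rootsE mem_filter andbC.
Qed.

(** * Multiplication by simple affine reflections *)

(** The finite root along which left multiplication of [z] by the
    reflection in [b] moves [z]. *)
Definition dir b z : 'cV[R]_n := z.1^T *m b.1.

Lemma dir_root b z : Waf z -> aroot b -> dir b z \in Phi.
Proof. by move=> [hw _] [bD _]; rewrite weyl_root //; exact: weylV. Qed.

Lemma dir_refl b z : Waf z -> aroot b -> dir b (refl b ** z) = - dir b z.
Proof.
move=> hz [bD _]; rewrite (amulE _ hz) /dir /= trmx_mul tr_reflection -mulmxA.
by rewrite reflection_self ?(root_nz bD) // mulmxN.
Qed.

Lemma asimple_root b : asimple b -> aroot b. Proof. by case. Qed.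

Lemma asimple_lt_bound b : asimple b -> aht b < ht_bound D.
Proof.
move=> [hb pb hs]; have [bD bI] := hb; rewrite ltNge; apply/negP => h.
have hc : aroot (b.1, b.2 - 1) by split; rewrite //= rpredB ?rpred1.
have ec : aht (b.1, b.2 - 1) = aht b - ht_bound D.
  by rewrite /aht /=; ring.
have nc : aht (b.1, b.2 - 1) < 0.
  have := aht_neq0 hc; rewrite neq_lt => /orP[//|pc]; exfalso.
  have cb : (b.1, b.2 - 1) <> b by move=> /(congr1 snd) /=; lra.
  have := hs _ hc pc cb; rewrite aht_refl /= dot_coroot_self ?(root_nz bD) //.
  by rewrite ec; have := ht_bound_gt0 D; lra.
by move: nc; rewrite ec; lra.
Qed.

Lemma asimple_sign b c : asimple b -> aroot c -> c <> b ->
  c <> (- b.1, - b.2) -> (aht (act (refl b) c) < 0) = (aht c < 0).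
Proof.
move=> [hb pb hs] hc cb cNb.
have hrc : aroot (act (refl b) c) by apply: aroot_act => //; exact: Waf_refl.
have := aht_neq0 hc; rewrite neq_lt => /orP[nc|pc]; last first.
  by rewrite !ltNge ltW ?hs // ltW.
rewrite nc; apply/idP; have hNc := aroot_opp hc.
have := @hs _ hNc; rewrite aht_neg oppr_gt0 nc => /(_ isT).
have -> : aht (act (refl b) (- c.1, - c.2)) = - aht (act (refl b) c).
  by rewrite !aht_refl /= aht_neg dotNr mulNr opprB addrC opprK.
rewrite oppr_gt0; apply => e; apply: cNb.
by rewrite -e /= !opprK -surjective_pairing.
Qed.

(** The reflection in [b] changes the sign of no affine root but [b] and its
    opposite, and [z] takes only roots of direction [dir b z], up to sign, to
    these. *)
Lemma cnt_simple b z e : asimple b -> Waf z -> e \in Phi ->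
  cnt (refl b ** z) e = cnt z e + (e == dir b z)%:R - (e == - dir b z)%:R.
Proof.
move=> hs hz eD; have [hb pb hs'] := hs; have hr := Waf_refl hb.
have hrz := WafM hr hz; have hw : weyl D z.1 by case: hz.
set d := dir b z; have dD : d \in Phi by exact: dir_root.
have d0 := root_nz dD.
have zd : z.1 *m d = b.1 by rewrite /d /dir (weyl_mulVmx _ hw).
have Nd : (d == - d) = false.
  apply/negbTE; rewrite -subr_eq0 opprK -mulr2n -scaler_nat scaler_eq0.
  by rewrite (negPf d0) orbF pnatr_eq0.
have main : cnt (refl b ** z) d = cnt z d + 1.
  pose m := b.2 + dot z.2 d.
  have mI : m \is a Num.int.
    by rewrite rpredD //; [case: hb|case: hz => _ h; exact: dot_qspan h dD].
  have az k : act z (d, k) = (b.1, b.2 + (k - m)).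
    by rewrite /affine_act /= zd /m; congr (_, _); ring.
  have ah k : aht (b.1, b.2 + k) = aht b + ht_bound D * k.
    by rewrite /aht /=; ring.
  have hbd := asimple_lt_bound hs; have hb0 := ht_bound_gt0 D.
  have -> : cnt z d = m.
    apply: eq_intP => // [|k kI]; first exact: cnt_int.
    rewrite -aht_act_lt0 // az ah.
    have kmI : k - m \is a Num.int by rewrite rpredB.
    apply/idP/idP => h.
      rewrite ltNge; apply/negP; rewrite -subr_ge0 => /(mulr_ge0 (ltW hb0)); lra.
    have : 1 <= m - k by apply: int_ge1; rewrite ?rpredB //; lra.
    by nra.
  apply: eq_intP => [||k kI]; [exact: cnt_int|by rewrite rpredD ?rpred1|].
  rewrite -aht_act_lt0 // (actM _ _ hz) az aht_refl ah /=.
  rewrite dot_coroot_self; last by case: hb => /root_nz.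
  rewrite ltr_int1 // -subr_le0.
  apply/idP/idP => h; last by nra.
  rewrite leNgt; apply/negP => h'.
  have : 1 <= k - m by apply: int_ge1; rewrite ?rpredB.
  by nra.
have [->|ed] := eqVneq e d; first by rewrite main Nd subr0.
have [->|eNd] := eqVneq e (- d).
  by rewrite !cntN // main addr0 /=; ring.
rewrite addr0 subr0; apply: eq_intP => [||k kI]; try exact: cnt_int.
rewrite -!(@aht_act_lt0 _ _ D) // (actM _ _ hz); apply: asimple_sign => //.
- by apply: aroot_act.
- move=> /(congr1 fst) /= h; move: ed; rewrite /d /dir -h.
  by rewrite (weyl_mulKmx _ hw) eqxx.
- move=> /(congr1 fst) /= h; move: eNd; rewrite /d /dir -[b.1]opprK -h mulmxN.
  by rewrite (weyl_mulKmx _ hw) opprK eqxx.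
Qed.

Lemma slen_simple_up J b z : asimple b -> Waf z -> 0 < ht J (dir b z) ->
  slen J (refl b ** z) = slen J z + 1.
Proof.
move=> hs hz hd; have hb := asimple_root hs; have dD := dir_root hz hb.
rewrite /slen; set d := dir b z in hd dD *.
transitivity (\sum_(e <- Phi | 0 < ht J e) (cnt z e + (e == d)%:R)).
  rewrite big_seq_cond [RHS]big_seq_cond; apply: eq_bigr => e /andP[eD he].
  rewrite cnt_simple // -/d; case: (eqVneq e (- d)) => [eN|_]; last by rewrite subr0.
  by move: he; rewrite eN htN oppr_gt0 ltNge ltW.
rewrite big_split; congr (_ + _); rewrite big_mkcond (bigD1_seq d) ?fset_uniq //=.
rewrite hd eqxx big1 ?addr0 // => e /negPf ->; by rewrite if_same.
Qed.

Lemma slen_simple_down J b z : asimple b -> Waf z -> ht J (dir b z) < 0 ->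
  slen J (refl b ** z) = slen J z - 1.
Proof.
move=> hs hz hd; have hb := asimple_root hs; have hr := Waf_refl hb.
have := @slen_simple_up J b (refl b ** z) hs (WafM hr hz).
rewrite dir_refl // htN oppr_gt0 hd (reflK hb hz) => /(_ isT) ->.
by rewrite addrK.
Qed.

(** * Minimal coset representatives *)

Lemma min_cosetE J z : affine_min_coset D J z <-> Waf z /\
  forall e, e \in Phi -> ht J e = 0 -> 0 < ht set0 e -> cnt z e = 0.
Proof.
split=> [[hz h]|[hz h]]; split=> //.
  move=> e eD he pe.
  have h0 : 0 < aht (act z (e, 0)).
    suff /h/pos_affine_rootE[] : pos_affine_root_in D J (e, 0) by [].
    by split; [exact/root_inE|left; rewrite pos_rootsE eD].
  have h1 : 0 < aht (act z (- e, 1)).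
    suff /h/pos_affine_rootE[] : pos_affine_root_in D J (- e, 1) by [].
    split; last by right; rewrite rpred1.
    by apply/root_inE; rewrite rootNE htN he oppr0.
  move: h0 h1; rewrite !aht_act_gt0 ?rpred0 ?rpred1 ?rootNE // cntN // => h0 h1.
  by apply/eqP; rewrite eq_le h0 /=; lra.
move=> b [/root_inE[bD hbJ] pb].
have /pos_affine_rootE[hb pb'] : pos_affine_root D b by [].
apply/pos_affine_rootE; split; first exact: aroot_act.
have [_ bI] := hb; rewrite [b]surjective_pairing aht_act_gt0 //.
move: pb'; rewrite aht_gt0 //; have := ht0_neq0 bD.
rewrite neq_lt => /orP[nb|ppb]; last first.
  by rewrite (h _ bD hbJ ppb) ltNge (ltW ppb).
have := @h (- b.1); rewrite rootNE bD !htN hbJ oppr0 oppr_gt0 nb cntN //.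
by move=> /(_ isT erefl isT) /=; lra.
Qed.

Lemma min_coset_Waf J z : affine_min_coset D J z -> Waf z.
Proof. by case. Qed.

Lemma min_coset_slen J z : affine_min_coset D J z ->
  slen J z = semi_infinite_length D z.
Proof.
move=> /min_cosetE[hz h]; rewrite semi_infinite_lengthE // /slen.
rewrite [RHS](bigID (fun e => 0 < ht J e)) /= [X in _ + X]big_seq_cond.
rewrite [X in _ + X]big1 ?addr0 => [|e /and3P[eD pe he]].
  rewrite big_seq_cond [RHS]big_seq_cond; apply: eq_bigl => e.
  case: (boolP (e \in Phi)) => //= eD; apply/idP/andP => [he|[]//].
  by split=> //; exact: ht_gt0W he.
apply: h => //; apply/eqP; rewrite eq_le leNgt he /=; exact: ht_geW.
Qed.

Lemma min_coset_simple J b z : asimple b -> affine_min_coset D J z ->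
  ht J (dir b z) != 0 -> affine_min_coset D J (refl b ** z).
Proof.
move=> hs /min_cosetE[hz h] hd; apply/min_cosetE; split.
  by apply: WafM => //; apply: Waf_refl; exact: asimple_root.
move=> e eD he pe; rewrite cnt_simple // h // add0r.
have [ed|_] := eqVneq e (dir b z); first by rewrite -ed he eqxx in hd.
have [ed|_] := eqVneq e (- dir b z); last by rewrite subrr.
by move: hd; rewrite -oppr_eq0 -htN -ed he eqxx.
Qed.

Lemma refl_stay J b z : aroot b -> Waf z -> ht J (dir b z) = 0 ->
  exists2 u, affine_weyl_parabolic D J u & refl b ** z = z ** u.
Proof.
move=> hb hz hd; have hg := aroot_act (WafV hz) hb.
exists (refl (act (ainv z) b)); first exact: aparabolic_refl.
by rewrite -(refl_conj hz hg) (actKV _ hz).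
Qed.

(** * Descending chains *)

(** Weak order: if [x'] has smaller counts than [x] in all positive directions,
    then [x'] is reached from [x] by simple reflections which all lower the
    length.  An inversion of [x' x^-1] which is a simple affine root gives the
    first step.  When the counts agree along [J], the length relative to [J] also
    drops at each step. *)
Lemma descent_ind J (T : affine R n -> Prop) x x' : Waf x -> Waf x' ->
  (forall e, e \in Phi -> 0 < ht set0 e -> cnt x' e <= cnt x e) ->
  (forall e, e \in Phi -> 0 < ht set0 e -> ht J e = 0 -> cnt x' e = cnt x e) ->
  T x ->
  (forall z b, Waf z -> asimple b -> ht J (dir b z) < 0 -> T z ->
     T (refl b ** z)) ->
  T x'.
Proof.
move=> hx hx' hle hJ Tx step.
have [m hm] : exists m : nat, slen set0 x - slen set0 x' < m%:R.
  have /intrP[[k|k] ->] : slen set0 x - slen set0 x' \is a Num.int.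
  - by rewrite rpredB ?slen_int.
  - by exists k.+1; rewrite ltr_nat.
  - by exists 0%N; rewrite ltrz0.
elim: m x hx hle hJ Tx hm => [|m IH] x hx hle hJ Tx hm.
  exfalso; move: hm; rewrite subr_lt0 ltNge => /negP; apply.
  rewrite /slen big_seq_cond [leRHS]big_seq_cond.
  by apply: ler_sum => e /andP[eD pe]; exact: hle.
have [u1|u1] := pselect (x' ** ainv x = aone R n).
  by rewrite -(amulVK hx' hx) u1 (a1mul hx).
have hu := WafM hx' (WafV hx).
have [b hs nb] := inversion_simple hu u1; have hb := asimple_root hs.
have hg := aroot_act (WafV hx) hb; have hrx := WafM (Waf_refl hb) hx.
have [dD dI] := hg; rewrite -[(act _ _).1]/(dir b x) in dD; set d := dir b x in dD.
have eg : (d, (act (ainv x) b).2) = act (ainv x) b by [].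
have lt_d : cnt x d < cnt x' d.
  apply: (@le_lt_trans _ _ (act (ainv x) b).2).
    by rewrite -(@aht_act_gt0 _ _ D) // eg (actKV _ hx); case: hs.
  by rewrite -(@aht_act_lt0 _ _ D) // eg -(actM _ _ (WafV hx)).
have nd : ht set0 d < 0.
  have := ht0_neq0 dD; rewrite neq_lt => /orP[//|/(hle _ dD)].
  by rewrite leNgt lt_d.
have NdD : - d \in Phi by rewrite rootNE.
have pNd : 0 < ht set0 (- d) by rewrite htN oppr_gt0.
have ndJ : ht J d < 0.
  have := ht_geW J NdD pNd; rewrite le_eqVlt => /orP[/eqP h0|]; last first.
    by rewrite htN oppr_gt0.
  have := hJ _ NdD pNd (esym h0); rewrite !cntN //; lra.
have step1 : cnt x d + 1 <= cnt x' d.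
  have : 1 <= cnt x' d - cnt x d.
    by apply: int_ge1; rewrite ?subr_gt0 // rpredB ?cnt_int.
  by lra.
have neq_d e : 0 < ht set0 e -> (e == d) = false.
  by move=> pe; apply: contraTF pe => /eqP ->; rewrite -leNgt ltW.
apply: (IH (refl b ** x)) => // [e eD pe|e eD pe he||].
- rewrite cnt_simple // -/d neq_d // addr0.
  have [->|_] := eqVneq e (- d); last by rewrite subr0; exact: hle.
  by rewrite !cntN //=; lra.
- rewrite cnt_simple // -/d neq_d // addr0 hJ //.
  have [ed|_] := eqVneq e (- d); last by rewrite subr0.
  move: he; rewrite ed htN => /eqP; rewrite oppr_eq0 => /eqP h0.
  by rewrite h0 ltxx in ndJ.
- exact: step.
by move: hm; rewrite slen_simple_down // -natr1; lra.
Qed.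

End Length.

(** * Coset projections *)

Section Order.
Variables (R : realType) (n : nat) (D : simpleRootSystem R n).
Implicit Types (J : {set 'I_n}) (w : 'M[R]_n) (a e v xi zeta : 'cV[R]_n).
Implicit Types (x y z u : affine R n) (b c g : affine_vector R n).

Local Notation alpha := (simple_root D).
Local Notation Phi := (Defs.roots D).
Local Notation Waf := (affine_weyl D).
Local Notation "x ** y" := (affine_mul x y) (at level 40, left associativity).
Local Notation refl := (@affine_reflection R n).
Local Notation act := (@affine_act R n).
Local Notation ht := (ht D).
Local Notation aht := (aht D).
Local Notation cnt := (cnt D).
Local Notation aroot := (aroot D).
Local Notation asimple := (asimple D).
Local Notation slen := (slen D).
Local Notation aone := (aone R n).
Local Notation Qvee := (int_span (simple_coroot D) [set: 'I_n]).
Local Notation proj := (affine_proj D).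
Local Notation mincos := (affine_min_coset D).
Local Notation WJaf := (affine_weyl_parabolic D).

Definition trans xi : affine R n := (1%:M, xi).

Lemma Waf_trans xi : Qvee xi -> Waf (trans xi).
Proof. by split=> //; exact: weyl1. Qed.

Lemma mul_trans z xi : Qvee xi -> z ** trans xi = (z.1, z.2 + xi).
Proof.
by move=> h; rewrite (amulE _ (Waf_trans h)) /= mulmx1 trmx1 mul1mx.
Qed.

Lemma cnt_mul_trans z xi e : Qvee xi ->
  cnt (z ** trans xi) e = cnt z e + dot xi e.
Proof. by move=> h; rewrite (cntM _ _ (Waf_trans h)) /= mul1mx. Qed.

Lemma cnt_trans xi e : 0 < ht set0 e -> cnt (trans xi) e = dot xi e.
Proof. by move=> h; rewrite /cnt /= mul1mx ltNge ltW // addr0. Qed.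

Lemma dir_mul_trans b z xi : Qvee xi -> dir b (z ** trans xi) = dir b z.
Proof. by move=> h; rewrite (mul_trans _ h). Qed.

(** The difference of [2 rho] for the coroots and its analogue for [J]: a dominant
    element of the coroot lattice which vanishes on the roots of [J] and on no
    others. *)
Definition rhoc J : 'cV[R]_n := \sum_(e <- Phi | 0 < ht J e) coroot e.

Lemma qspan_rhoc J : Qvee (rhoc J).
Proof. by apply: qspan_sum => e eD _; exact: qspan_coroot. Qed.

Lemma dot_rhocE J a : dot (rhoc J) a =
  \sum_(e <- Phi | 0 < ht J e) (2 / dot e e) * dot a e.
Proof.
by rewrite dot_suml; apply: eq_bigr => e _; rewrite /coroot dotZl (dotC e a).
Qed.

Lemma dot_rhoc_gt0 J a : a \in Phi -> 0 < ht J a -> 0 < dot (rhoc J) a.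
Proof.
move=> aD ha; rewrite dot_rhocE.
apply: (@sum_pairing_gt0 _ _ D J (fun e => 2 / dot e e)) => // e eD.
  by rewrite divr_gt0 // dot_gt0 (root_nz eD).
by rewrite (dot_weyl _ _ (weyl_reflection aD)).
Qed.

Lemma dot_rhoc_eq0 J a : a \in Phi -> ht J a = 0 -> dot (rhoc J) a = 0.
Proof.
move=> aD ha; rewrite dot_rhocE.
apply: (@sum_pairing_eq0 _ _ D J (fun e => 2 / dot e e)) => // e eD.
by rewrite (dot_weyl _ _ (weyl_reflection aD)).
Qed.

Lemma dot_rhoc_ge0 J a : a \in Phi -> 0 < ht set0 a -> 0 <= dot (rhoc J) a.
Proof.
move=> aD pa; have := ht_geW J aD pa; rewrite le_eqVlt => /orP[/eqP h|h].
  by rewrite dot_rhoc_eq0.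
by rewrite ltW // dot_rhoc_gt0.
Qed.

Lemma dot_rhoc_ge1 a : a \in Phi -> 0 < ht set0 a -> 1 <= dot (rhoc set0) a.
Proof.
move=> aD pa; apply: int_ge1; last exact: dot_rhoc_gt0.
exact: dot_qspan (qspan_rhoc _) aD.
Qed.

Definition root_sum J : 'cV[R]_n := \sum_(e <- Phi | 0 < ht J e) e.

Lemma dot_root_sum_gt0 J a : a \in Phi -> 0 < ht J a ->
  0 < dot a (root_sum J).
Proof.
move=> aD ha; rewrite dot_sumr.
have := @sum_pairing_gt0 _ _ D J (fun=> 1) _ aD ha.
by under eq_bigr do rewrite mul1r; apply.
Qed.

Lemma slen_mul_trans J z xi : Qvee xi ->
  slen J (z ** trans xi) = slen J z + dot xi (root_sum J).
Proof.
move=> h; rewrite slen_translate; last exact: Waf_trans.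
by congr (_ + _); apply: eq_bigr => e _; rewrite mul1mx.
Qed.

Definition factors J z : Prop :=
  exists x1 u, [/\ mincos J x1, WJaf J u & z = x1 ** u].

Lemma factors_simple J b z : asimple b -> factors J z -> factors J (refl b ** z).
Proof.
move=> hs [x1 [u [h1 hu ->]]]; have hx1 := min_coset_Waf h1.
have hb := asimple_root hs; have huW := parabolic_affine hu.
have [h0|hn0] := eqVneq (ht J (dir b x1)) 0; last first.
  exists (refl b ** x1), u; split=> //; first exact: min_coset_simple.
  exact: amulA hx1 huW.
have [u' hu' e] := refl_stay hb hx1 h0.
exists x1, (u' ** u); split=> //; first exact: aparabolicM.
by rewrite (amulA _ hx1 huW) e (amulA _ (parabolic_affine hu') huW).
Qed.

Lemma min_coset1 J : mincos J aone.
Proof. by apply/min_cosetE; split=> [|e _ _ pe]; [exact: Waf1|exact: cnt1]. Qed.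

(** A large multiple of [- rhoc set0] has smaller counts than [z] and than the
    identity. *)
Lemma deep_trans z : Waf z -> exists2 xi, Qvee xi &
  forall e, e \in Phi -> 0 < ht set0 e -> dot xi e <= cnt z e /\ dot xi e <= 0.
Proof.
move=> hz; pose N := Num.bound (\sum_(e <- Phi) `|cnt z e|).
exists (- (N%:R *: rhoc set0)) => [|e eD pe].
  by apply: qspanN; apply: qspanZ; [exact: rpred_nat|exact: qspan_rhoc].
have hN : `|cnt z e| <= N%:R.
  have := archi_boundP (_ : 0 <= \sum_(e <- Phi) `|cnt z e|).
  move=> /(_ (sumr_ge0 _ (fun _ _ => normr_ge0 _)))/ltW; apply: le_trans.
  rewrite (bigD1_seq e) ?fset_uniq //= lerDl.
  exact: sumr_ge0 (fun _ _ => normr_ge0 _).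
have h1 := dot_rhoc_ge1 eD pe; have h2 : N%:R <= N%:R * dot (rhoc set0) e.
  by rewrite ler_peMr.
rewrite dotNl dotZl oppr_le0; split.
  by rewrite lerNl (le_trans _ h2) // (le_trans _ hN) // -normrN ler_norm.
by rewrite (le_trans _ h2).
Qed.

(** The affine Weyl group is generated by the simple reflections: by
    [descent_ind] both the identity and [z] descend to a common translation. *)
Lemma simple_connected (Q : affine R n -> Prop) z : Waf z -> Q aone ->
  (forall x b, Waf x -> asimple b -> Q x -> Q (refl b ** x)) -> Q z.
Proof.
move=> hz Q1 step; have [xi hxi h] := deep_trans hz.
have stepE x b : Waf x -> asimple b -> Q x <-> Q (refl b ** x).
  move=> hx hs; split; first exact: step.
  have hb := asimple_root hs; have hr := Waf_refl hb.
  by move/(step _ b (WafM hr hx) hs); rewrite (reflK hb hx).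
have low x : Waf x -> (forall e, e \in Phi -> 0 < ht set0 e -> dot xi e <= cnt x e) ->
    Q (trans xi) <-> Q x.
  move=> hx hle; apply: (@descent_ind _ _ D set0 (fun z => Q z <-> Q x) x) => //.
  - exact: Waf_trans.
  - by move=> e eD pe; rewrite cnt_trans //; exact: hle.
  - by move=> e eD pe he; rewrite he ltxx in pe.
  - by move=> y b hy hs _; rewrite (stepE y b).
apply/(low z hz) => [e eD pe|]; first by have [] := h e eD pe.
apply/(low aone) => //; first exact: Waf1.
by move=> e eD pe; rewrite cnt1 //; have [] := h e eD pe.
Qed.

Lemma factors_ex J z : Waf z -> factors J z.
Proof.
move=> hz; apply: (simple_connected hz) => [|x b _ hs]; last exact: factors_simple.
exists aone, aone; split; rewrite ?amul1 //; first exact: min_coset1.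
exact: aparabolic1.
Qed.

Lemma cnt_min_coset J z e : mincos J z -> e \in Phi -> ht J e = 0 ->
  cnt z e = (ht set0 e < 0)%R%:R.
Proof.
move=> /min_cosetE[hz h] eD he; have := ht0_neq0 eD.
rewrite neq_lt => /orP[n0|p0]; last by rewrite h // ltNge ltW.
rewrite n0 -[e]opprK cntN ?rootNE // h ?subr0 // ?rootNE ?htN ?oppr_gt0 //.
by rewrite he oppr0.
Qed.

Lemma min_coset_unique J x u : mincos J x -> WJaf J u -> mincos J (x ** u) ->
  u = aone.
Proof.
move=> hx hu hxu; have hW := parabolic_affine hu.
apply: (aparabolic_cnt0 hu) => e eD he pe.
have := cnt_min_coset hxu eD he; rewrite (cntM _ _ hW) ltNge (ltW pe) /=.
rewrite (cnt_min_coset hx); [|by rewrite weyl_root //; case: hW|].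
  by rewrite addrC.
by rewrite (ht_parabolic _ (proj1 hu)).
Qed.

Lemma proj_spec J z : Waf z ->
  mincos J (proj J z) /\ exists2 u, WJaf J u & z = proj J z ** u.
Proof.
move=> hz; have [x1 [u [h1 h2 h3]]] := factors_ex J hz.
rewrite /affine_proj; set P := (X in xget _ X).
have /(xgetPex z)[] : exists x1, P x1 by exists x1; split=> //; exists u.
by [].
Qed.

Lemma proj_min J z : Waf z -> mincos J (proj J z).
Proof. by move/(proj_spec J) => []. Qed.

Lemma proj_Waf J z : Waf z -> Waf (proj J z).
Proof. by move/(proj_min J); exact: min_coset_Waf. Qed.

Lemma proj_eq J x u : mincos J x -> WJaf J u -> proj J (x ** u) = x.
Proof.
move=> hx hu; have huW := parabolic_affine hu; have hxW := min_coset_Waf hx.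
have [hp [u' hu' e]] := proj_spec J (WafM hxW huW).
have hu'W := parabolic_affine hu'.
have ep : proj J (x ** u) = x ** (u ** ainv u').
  rewrite (amulA _ huW (WafV hu'W)) [in RHS]e (amulKV _ hu'W) //.
  exact: min_coset_Waf hp.
have hu2 : WJaf J (u ** ainv u') by apply: aparabolicM => //; exact: aparabolicV.
by rewrite ep in hp *; rewrite (min_coset_unique hx hu2 hp) amul1.
Qed.

Lemma proj_id J x : mincos J x -> proj J x = x.
Proof. by move=> hx; have := proj_eq hx (aparabolic1 D J); rewrite amul1. Qed.

Lemma proj_parabolic J z u : Waf z -> WJaf J u -> proj J (z ** u) = proj J z.
Proof.
move=> hz hu; have [hp [u' hu' e]] := proj_spec J hz.
rewrite {1}e -(amulA _ (parabolic_affine hu') (parabolic_affine hu)).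
by apply: proj_eq => //; exact: aparabolicM.
Qed.

Lemma ht_dir_proj J b z : Waf z -> ht J (dir b (proj J z)) = ht J (dir b z).
Proof.
move=> hz; have [hp [u hu e]] := proj_spec J hz.
have -> : dir b z = u.1^T *m dir b (proj J z).
  by rewrite {1}e (amulE _ (parabolic_affine hu)) /dir /= trmx_mul mulmxA.
by rewrite (ht_parabolic _ (parabolicV (proj1 hu))).
Qed.

Lemma slen_proj J z : Waf z -> slen J (proj J z) = slen J z.
Proof. by move/(proj_spec J) => [_ [u hu e]]; rewrite [in RHS]e slen_parabolic. Qed.

Lemma proj_simple J b z : asimple b -> Waf z -> ht J (dir b z) != 0 ->
  proj J (refl b ** z) = refl b ** proj J z.
Proof.
move=> hs hz hd; have [hp [u hu e]] := proj_spec J hz.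
rewrite {1}e (amulA _ (min_coset_Waf hp) (parabolic_affine hu)).
by apply: proj_eq => //; apply: min_coset_simple; rewrite ?ht_dir_proj.
Qed.

Lemma proj_refl_stay J b z : aroot b -> Waf z -> ht J (dir b z) = 0 ->
  proj J (refl b ** z) = proj J z.
Proof.
by move=> hb hz hd; have [u hu ->] := refl_stay hb hz hd; exact: proj_parabolic.
Qed.

(** * The semi-infinite order on cosets *)

Definition sge J x y : Prop := semi_infinite_ge D J (proj J x) (proj J y).

Lemma sge_refl J x : sge J x x.
Proof. exact: rt_refl. Qed.

Lemma sge_trans J y x z : sge J x y -> sge J y z -> sge J x z.
Proof. by move=> h1 h2; apply: rt_trans h2 h1. Qed.

Lemma sge_parabolic J z u : Waf z -> WJaf J u -> sge J (z ** u) z.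
Proof. by move=> hz hu; rewrite /sge proj_parabolic //; exact: rt_refl. Qed.

Lemma sge_simple_up J b z : asimple b -> Waf z -> 0 <= ht J (dir b z) ->
  sge J (refl b ** z) z.
Proof.
move=> hs hz; have hb := asimple_root hs; rewrite le_eqVlt => /orP[/eqP h0|hd].
  by rewrite /sge proj_refl_stay //; exact: rt_refl.
have hd' : ht J (dir b z) != 0 by rewrite gt_eqF.
have hp := proj_min J hz; have hpW := proj_Waf J hz.
rewrite /sge proj_simple //; apply: rt_step.
have hrp : mincos J (refl b ** proj J z).
  by apply: min_coset_simple; rewrite ?ht_dir_proj.
split=> //; exists b; split=> //; first by apply/pos_affine_rootE; case: hs.
by rewrite -!(@min_coset_slen _ _ D J) // slen_simple_up // ht_dir_proj.
Qed.

Lemma sge_simple_down J b z : asimple b -> Waf z -> ht J (dir b z) <= 0 ->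
  sge J z (refl b ** z).
Proof.
move=> hs hz hd; have hb := asimple_root hs; have hr := Waf_refl hb.
rewrite -{1}(reflK hb hz); apply: sge_simple_up => //; first exact: WafM.
by rewrite (dir_refl hz hb) htN oppr_ge0.
Qed.

(** * Lifting *)

Definition down J b z : affine R n :=
  if ht J (dir b z) < 0 then refl b ** z else z.

Definition up J b z : affine R n :=
  if 0 < ht J (dir b z) then refl b ** z else z.

(** The converse of the sign rule: if [g] pointed in a negative direction off
    [J], the rule would apply to the opposite root and the reflected element. *)
Lemma rise_dir J z g : Waf z -> aroot g -> 0 < aht (act z g) ->
  slen J z < slen J (z ** refl g) -> 0 < ht J g.1.
Proof.
move=> hz hg pg; rewrite !ltNge; apply: contraNN; rewrite le_eqVlt => /orP[/eqP h0|hn].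
  by rewrite slen_parabolic //; exact: aparabolic_refl.
have hg' := aroot_opp hg; have hr := Waf_refl hg; have hzg := aroot_act hz hg.
have h1 : 0 < ht J (- g.1, - g.2).1 by rewrite htN oppr_gt0.
have h2 : 0 < aht (act (z ** refl g) (- g.1, - g.2)).
  by rewrite -(act_refl_self hg) -(actM _ _ hr) (reflKr hg hz).
have := slen_refl (WafM hz hr) hg' h1 h2.
by rewrite refl_opp (reflKr hg hz) => /ltW.
Qed.

Lemma edge_reflection J y x : semi_infinite_edge D J y x ->
  exists g, [/\ aroot g, 0 < ht J g.1, 0 < aht (act y g), x = y ** refl g &
    slen J x = slen J y + 1].
Proof.
move=> [my mx [c [/pos_affine_rootE[hc pc] ex]]].
have hy := min_coset_Waf my; rewrite -!(@min_coset_slen _ _ D J) // => lx.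
have hg := aroot_act (WafV hy) hc; exists (act (ainv y) c).
have eg : act y (act (ainv y) c) = c by rewrite (actKV _ hy).
have xyg : x = y ** refl (act (ainv y) c) by rewrite ex -(refl_conj hy hg) eg.
rewrite eg; split=> //; apply: (rise_dir hy hg); rewrite ?eg //.
by rewrite -xyg lx ltrDl.
Qed.

(** The lifting property.  Let [x] be obtained from [y] by reflecting in [c].  If
    [c] is [b], both sides collapse.  Otherwise the reflection in [b] keeps [c]
    positive, so by the sign rule it also keeps [y] below [x] in length.  As the
    lengths of [x] and [y] differ by one, this excludes the cases where [x]
    comes down and [y] does not, and where [y] goes up and [x] stays; in all the
    other cases the comparison follows from the given edge, its image under the
    reflection, or the edges along [b]. *)
Lemma up_down_edge J b x y : asimple b -> semi_infinite_edge D J y x ->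
  semi_infinite_ge D J (down J b x) (down J b y) /\
  semi_infinite_ge D J (up J b x) (up J b y).
Proof.
move=> hs hedge; have eyx := rt_step _ _ _ _ hedge.
have [g [hg pg pc xyg lx]] := edge_reflection hedge.
case: hedge => my mx _; have hy := min_coset_Waf my; have hx := min_coset_Waf mx.
have hb := asimple_root hs; have hr := Waf_refl hb.
set c := act y g in pc; have hc : aroot c by exact: aroot_act.
have ex : x = refl c ** y by rewrite /c (refl_conj hy hg).
have [cb|cb] := pselect (c = b).
  have dy : 0 < ht J (dir b y).
    by rewrite -cb /dir /c /= (weyl_mulKmx _ (proj1 hy)).
  have dx : ht J (dir b x) < 0 by rewrite ex cb (dir_refl hy hb) htN oppr_lt0.
  rewrite /down /up dx dy ltNge (ltW dy) ltNge (ltW dx) /= ex cb (reflK hb hy).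
  by split; exact: rt_refl.
have lt_s : slen J (refl b ** y) < slen J (refl b ** x).
  have hry := WafM hr hy; rewrite xyg (amulA _ hy (Waf_refl hg)).
  rewrite slen_refl_lt // (actM _ _ hy) -/c.
  by case: hs => _ _; apply.
have sx := slen_simple_up (J := J) hs; have sy := slen_simple_down (J := J) hs.
have stay z : Waf z -> ht J (dir b z) = 0 -> slen J (refl b ** z) = slen J z.
  by move=> hz /(refl_stay hb hz)[u hu ->]; exact: slen_parabolic.
have edge : ht J (dir b y) != 0 -> ht J (dir b x) != 0 ->
    slen J (refl b ** x) = slen J (refl b ** y) + 1 ->
    semi_infinite_ge D J (refl b ** x) (refl b ** y).
  move=> hy0 hx0 ls; apply: rt_step.
  have m1 := min_coset_simple hs my hy0; have m2 := min_coset_simple hs mx hx0.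
  split=> //; exists (act (refl b) c); split.
  - apply/pos_affine_rootE; split; first exact: aroot_act.
    by case: hs => _ _; apply.
  - rewrite (amulA _ hr hy) (refl_conj hr hc) ex.
    by rewrite -(amulA _ (Waf_refl hc) hy).
  - by rewrite -!(@min_coset_slen _ _ D J).
have upx z : mincos J z -> 0 < ht J (dir b z) ->
    semi_infinite_ge D J (refl b ** z) z.
  move=> mz dz; have := sge_simple_up hs (min_coset_Waf mz) (ltW dz).
  rewrite /sge (proj_id mz) proj_id //; apply: min_coset_simple => //.
  by rewrite gt_eqF.
have downx z : mincos J z -> ht J (dir b z) < 0 ->
    semi_infinite_ge D J z (refl b ** z).
  move=> mz dz; have := sge_simple_down hs (min_coset_Waf mz) (ltW dz).
  rewrite /sge (proj_id mz) proj_id //; apply: min_coset_simple => //.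
  by rewrite lt_eqF.
have trans p q r : semi_infinite_ge D J p q -> semi_infinite_ge D J q r ->
    semi_infinite_ge D J p r by move=> h1 h2; apply: rt_trans h2 h1.
rewrite /down /up.
case: (ltgtP (ht J (dir b x)) 0) => dx; case: (ltgtP (ht J (dir b y)) 0) => dy.
- split=> //; apply: edge; rewrite ?lt_eqF //.
  by rewrite (sy _ hx dx) (sy _ hy dy) lx; ring.
- by move: lt_s; rewrite (sx _ hy dy) (sy _ hx dx) lx; lra.
- by move: lt_s; rewrite (stay _ hy dy) (sy _ hx dx) lx; lra.
- by split; [apply: trans (downx _ my dy)|apply: trans eyx; exact: upx].
- split=> //; apply: edge; rewrite ?gt_eqF //.
  by rewrite (sx _ hx dx) (sx _ hy dy) lx; ring.
- by split=> //; apply: trans eyx; exact: upx.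
- by split=> //; apply: trans (downx _ my dy).
- by move: lt_s; rewrite (sx _ hy dy) (stay _ hx dx) lx; lra.
- by [].
Qed.

Lemma proj_down J b z : asimple b -> Waf z ->
  proj J (down J b z) = down J b (proj J z).
Proof.
move=> hs hz; rewrite /down ht_dir_proj //; case: ifP => // h.
by rewrite proj_simple // lt_eqF.
Qed.

Lemma proj_up J b z : asimple b -> Waf z ->
  proj J (up J b z) = up J b (proj J z).
Proof.
move=> hs hz; rewrite /up ht_dir_proj //; case: ifP => // h.
by rewrite proj_simple // gt_eqF.
Qed.

Lemma sge_up_down J b x y : asimple b -> Waf x -> Waf y -> sge J x y ->
  sge J (down J b x) (down J b y) /\ sge J (up J b x) (up J b y).
Proof.
move=> hs hx hy; rewrite /sge !proj_down // !proj_up //.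
move: (proj J x) (proj J y) => p q.
elim=> {p q} [p q h|p|p q r _ [h1 h2] _ [h3 h4]].
- exact: up_down_edge.
- by split; exact: rt_refl.
- by split; [exact: rt_trans h1 h3|exact: rt_trans h2 h4].
Qed.

Lemma sge_down J b x y : asimple b -> Waf x -> Waf y -> sge J x y ->
  sge J (down J b x) (down J b y).
Proof. by move=> hs hx hy /(sge_up_down hs hx hy)[]. Qed.

Lemma sge_up J b x y : asimple b -> Waf x -> Waf y -> sge J x y ->
  sge J (up J b x) (up J b y).
Proof. by move=> hs hx hy /(sge_up_down hs hx hy)[]. Qed.

End Order.

(** * Reflections that raise the length *)

Section Criterion.
Variables (R : realType) (n : nat) (D : simpleRootSystem R n).
Implicit Types (J : {set 'I_n}) (w : 'M[R]_n) (a e v xi zeta : 'cV[R]_n).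
Implicit Types (x y z u : affine R n) (b c g : affine_vector R n).

Local Notation alpha := (simple_root D).
Local Notation Phi := (Defs.roots D).
Local Notation Waf := (affine_weyl D).
Local Notation "x ** y" := (affine_mul x y) (at level 40, left associativity).
Local Notation refl := (@affine_reflection R n).
Local Notation act := (@affine_act R n).
Local Notation ht := (ht D).
Local Notation aht := (aht D).
Local Notation cnt := (cnt D).
Local Notation aroot := (aroot D).
Local Notation asimple := (asimple D).
Local Notation slen := (slen D).
Local Notation aone := (aone R n).
Local Notation Qvee := (int_span (simple_coroot D) [set: 'I_n]).
Local Notation proj := (affine_proj D).
Local Notation mincos := (affine_min_coset D).
Local Notation WJaf := (affine_weyl_parabolic D).


Local Notation trans := (@trans R n).
Local Notation rhoc := (rhoc D).
Local Notation sge := (sge D).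
Local Notation root_sum := (root_sum D).
Local Notation down := (down D).
Local Notation up := (up D).

Lemma real_induction (T : Type) (f : T -> R) (P : T -> Prop) :
  (forall p, (forall q, f q <= f p - 1 -> P q) -> P p) ->
  (forall p, f p < 0 -> P p) -> forall p, P p.
Proof.
move=> step base p; have [m] : exists m : nat, f p < m%:R.
  have [h|h] := ltP (f p) 0; first by exists 0%N.
  by exists (Num.bound (f p)); exact: archi_boundP.
elim: m p => [|m IH] p hm; first exact: base.
apply: step => q hq; apply: IH; apply: le_lt_trans hq _.
by move: hm; rewrite -natr1; lra.
Qed.

Lemma up_desc J b z : asimple b -> Waf z -> ht J (dir b z) < 0 ->
  up J b (refl b ** z) = z.
Proof.
move=> hs hz hd; have hb := asimple_root hs.
by rewrite /up (dir_refl hz hb) htN oppr_gt0 hd (reflK hb hz).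
Qed.

(** The chain property: the lengths of the two cosets may differ by more than
    one, but then there is a path of edges.  Both elements are lowered by
    simple reflections.  If at some step only the larger one is lowered, then the
    lengths come closer and induction applies.  Such a step must occur while the
    larger one descends to its translate by [- rhoc J], since otherwise [rhoc J]
    and its reflection in [g] would have the same pairing with [root_sum J]. *)
Lemma sge_refl_lt J g y : Waf y -> aroot g -> 0 < ht J g.1 ->
  0 < aht (act y g) -> sge J (y ** refl g) y.
Proof.
move=> hy hg pg; have hr := Waf_refl hg.
pose P y := Waf y -> 0 < aht (act y g) -> sge J (y ** refl g) y.
move: y hy; suff H y : P y by move=> y hy; exact: H.
apply: (@real_induction _ (fun y => slen J (y ** refl g) - slen J y) P) y; last first.
  move=> y; rewrite subr_lt0 => h hy py.
  by have := slen_refl hy hg pg py; rewrite ltNge ltW.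
rewrite /P => {P} y IH hy py; have hx := WafM hy hr.
set x := y ** refl g in IH hx *.
have lt_xy : slen J y < slen J x by exact: slen_refl.
have hrho := qspan_rhoc D J; have hNrho := qspanN hrho.
(* Here [z] is the lowered [x].  The lowered [y] is [z ** refl g], as left and
   right multiplication commute. *)
pose T z := sge J x y \/ [/\ Waf z,
  slen J z - slen J (z ** refl g) = slen J x - slen J y &
  sge J z (z ** refl g) -> sge J x y].
suff : T (x ** trans (- rhoc J)).
  have hq : Qvee (- (reflection g.1 *m rhoc J)).
    by apply: qspanN; apply: qspan_parabolic => //; case: hr.
  case=> // -[_ e _]; exfalso; move: e.
  have -> : x ** trans (- rhoc J) ** refl g =
      y ** trans (- (reflection g.1 *m rhoc J)).
    rewrite /x -!(amulA _ _ hr) ?(amulA _ _ hr) //; try exact: Waf_trans.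
    rewrite -(amulA _ hr (Waf_trans hNrho)) -(amulA _ (WafM hr (Waf_trans hNrho)) hr).
    congr (_ ** _); rewrite (mul_trans _ hNrho) (amulE _ hr) /=.
    rewrite reflection_sq ?(root_nz (proj1 hg)) // tr_reflection /trans.
    congr (_, _); rewrite mulmxDr mulmxN addrAC.
    have := congr1 snd (refl_sq hg); rewrite (amulE _ hr) /= tr_reflection => ->.
    by rewrite add0r.
  rewrite (slen_mul_trans _ _ hNrho) (slen_mul_trans _ _ hq).
  rewrite !dotNl reflectionE dotBl dotZl => e.
  have := mulr_gt0 (_ : 0 < dot (coroot g.1) (rhoc J)) (dot_root_sum_gt0 (proj1 hg) pg).
  rewrite dot_coroot_gt0 ?(root_nz (proj1 hg)) // dotC dot_rhoc_gt0 //; last by case: hg.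
  by move=> /(_ isT); lra.
apply: (@descent_ind _ _ D J T x) => //.
- by apply: WafM => //; exact: Waf_trans.
- move=> e eD pe; rewrite cnt_mul_trans // dotNl gerDl oppr_le0.
  exact: dot_rhoc_ge0.
- by move=> e eD pe he; rewrite cnt_mul_trans // dotNl dot_rhoc_eq0 // oppr0 addr0.
- by right; rewrite /x (reflKr hg hy).
move=> z b hz hs dz [|[_ ez imp]]; first by left.
have hb := asimple_root hs; have hrb := Waf_refl hb.
set y' := z ** refl g in ez imp; have hy' : Waf y' by exact: WafM.
have zy' : z = y' ** refl g by rewrite /y' (reflKr hg hz).
have py' : 0 < aht (act y' g).
  by rewrite -(slen_refl_lt hy' hg pg) -zy' -subr_gt0 ez subr_gt0.
have sz := slen_simple_down hs hz dz.
have [dy|dy] := ltP (ht J (dir b y')) 0.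
  right; have e : refl b ** z ** refl g = refl b ** y'.
    by rewrite -(amulA _ hz hr).
  split; first exact: WafM.
    by rewrite e sz slen_simple_down // -ez; ring.
  rewrite e => h; apply: imp.
  have := sge_up hs (WafM hrb hz) (WafM hrb hy') h.
  by rewrite !up_desc.
left; apply: imp.
have [yb|yb] := pselect (act y' g = b).
  by rewrite zy' -(refl_conj hy' hg) yb; exact: sge_simple_up.
have ly : slen J y' <= slen J (refl b ** y').
  move: dy; rewrite le_eqVlt => /orP[/eqP dy|dy].
    by have [u hu ->] := refl_stay hb hy' (esym dy); rewrite slen_parabolic.
  by rewrite slen_simple_up // lerDl.
have e : refl b ** y' ** refl g = refl b ** z.
  by rewrite -(amulA _ hy' hr) -zy'.
apply: (@sge_trans _ _ D J (refl b ** z)); first by apply: sge_simple_down; rewrite ?ltW.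
apply: (@sge_trans _ _ D J (refl b ** y')); last exact: sge_simple_up.
rewrite -e; apply: IH; first by rewrite e sz; lra.
  exact: WafM.
by rewrite (actM _ _ hy'); case: hs => _ _; apply => //; exact: aroot_act.
Qed.

Lemma sge_reflection J g y : Waf y -> aroot g -> 0 <= ht J g.1 ->
  0 < aht (act y g) -> sge J (y ** refl g) y.
Proof.
move=> hy hg; rewrite le_eqVlt => /orP[/eqP h0|h]; last exact: sge_refl_lt.
by move=> _; apply: sge_parabolic => //; exact: aparabolic_refl.
Qed.

(** * Comparing translations *)

Lemma transD xi zeta : Qvee zeta -> trans (xi + zeta) = trans xi ** trans zeta.
Proof. by move=> h; rewrite (mul_trans _ h). Qed.

(** The step is the reflection in [alpha i] followed by the one in
    [- alpha i + delta], and both move in the direction [alpha i]. *)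
Lemma sge_trans_simple_coroot J i xi : Qvee xi ->
  sge J (trans (xi + simple_coroot D i)) (trans xi).
Proof.
move=> hxi; have hx := Waf_trans hxi; have aD := simple_root_in D i.
have ha0 : 0 <= ht J (alpha i) by rewrite ht_alpha ler0n.
pose k := dot xi (alpha i); have kI : k \is a Num.int by exact: dot_qspan hxi aD.
pose g1 : affine_vector R n := (alpha i, k).
pose g2 : affine_vector R n := (alpha i, k + 1).
have hg1 : aroot g1 by [].
have hg2 : aroot g2 by split; rewrite //= rpredD ?rpred1.
have hr1 := Waf_refl hg1; have hr2 := Waf_refl hg2.
have -> : trans (xi + simple_coroot D i) = trans xi ** refl g1 ** refl g2.
  rewrite -(amulA _ hr1 hr2) transD; last by apply: qspan_simple; rewrite inE.
  congr (_ ** _); rewrite (amulE _ hr2) /= reflection_sq ?alpha_nz //.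
  rewrite tr_reflection -scalemxAr -(coroot_weyl _ (weyl_reflection aD)).
  rewrite reflection_self ?alpha_nz // corootN scalerN scalerDl scale1r.
  by rewrite addKr.
have p1 : 0 < aht (act (trans xi) g1).
  by rewrite aht_act_gt0 // cnt_trans // ht_alpha inE ltr01.
apply: (@sge_trans _ _ D J (trans xi ** refl g1)); last exact: sge_reflection.
apply: sge_reflection => //; first exact: WafM.
rewrite (actM _ _ hr1) aht_act_refl /= dot_coroot_self ?alpha_nz //.
rewrite /aht /affine_act /= mul1mx -/k ht_alpha inE /=.
by have := ht_bound_gt aD; rewrite ht_alpha inE normr1 /=; lra.
Qed.

Lemma edge_coef J y x i : semi_infinite_edge D J y x ->
  coef D i y.2 <= coef D i x.2.
Proof.
move=> h; have [g [hg pg pc -> _]] := edge_reflection h.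
have hy : Waf y by case: h => /min_coset_Waf.
have gD := proj1 hg; have pg0 := ht_gt0W gD pg.
rewrite (amulE _ (Waf_refl hg)) /= tr_reflection reflectionE.
rewrite dot_coroot_swap -addrA addrC -scaleNr -scalerDl addrC coefD lerDl.
rewrite coefZ coef_coroot mulr_ge0 //; last first.
  by rewrite mulr_ge0 ?divr_ge0 ?dot_ge0 // pos_coef.
move: pc; rewrite aht_gt0; last exact: aroot_act.
by rewrite /= (dotC g.1) addrC; apply: le_trans; rewrite ler0n.
Qed.

Lemma coef_proj J z i : Waf z -> i \notin J ->
  coef D i (proj J z).2 = coef D i z.2.
Proof.
move=> hz iJ; have [hp [u hu e]] := proj_spec J hz.
rewrite [in RHS]e (amulE _ (parabolic_affine hu)) /= coefD.
rewrite (coef_parabolic _ (parabolicV (proj1 hu)) iJ).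
by rewrite (qspan_coef (proj2 hu) iJ) addr0.
Qed.

Lemma sge_coef J x y i : Waf x -> Waf y -> i \notin J -> sge J x y ->
  coef D i y.2 <= coef D i x.2.
Proof.
move=> hx hy iJ; rewrite -(coef_proj hx iJ) -(coef_proj hy iJ) /sge.
elim=> {hx hy} [p q|p|p q r _ h1 _ h2]; [exact: edge_coef|by []|].
exact: le_trans h1 h2.
Qed.

(** Along an edge the translation part grows by a nonnegative multiple of a
    positive coroot, and a change of representative only affects the coordinates
    in [J].  Conversely, adding a simple coroot goes up in the order, and a
    coroot of [J] can be added or subtracted inside the coset. *)
Lemma sge_transE J xi zeta : Qvee xi -> Qvee zeta ->
  sge J (trans xi) (trans zeta) <->
  forall i, i \notin J -> coef D i zeta <= coef D i xi.
Proof.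
move=> hxi hzeta; split.
  move=> h i iJ; exact: (sge_coef (Waf_trans hxi) (Waf_trans hzeta) iJ h).
pose M kappa := Qvee kappa /\ forall eta, Qvee eta ->
  sge J (trans (eta + kappa)) (trans eta).
have M0 : M 0.
  by split=> [|eta _]; [exact: qspan0|rewrite addr0; exact: sge_refl].
have MD k1 k2 : M k1 -> M k2 -> M (k1 + k2).
  move=> [q1 h1] [q2 h2]; split=> [|eta he]; first exact: qspanD.
  rewrite addrA; apply: (@sge_trans _ _ D J (trans (eta + k1))); last exact: h1.
  by apply: h2; exact: qspanD.
have Mi i : M (simple_coroot D i).
  split=> [|eta]; first by apply: qspan_simple; rewrite inE.
  exact: sge_trans_simple_coroot.
move=> h; suff : M (xi - zeta).
  by case=> _ /(_ _ hzeta); rewrite addrC subrK.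
have hd : Qvee (xi - zeta) by apply: qspanD => //; exact: qspanN.
have hle i : i \notin J -> 0 <= coef D i (xi - zeta).
  by move=> iJ; rewrite coefD coefN subr_ge0 h.
case: hd hle => c -> hle.
elim/big_ind: _ => // i _; have [iJ|iJ] := boolP (i \in J).
  have q : int_span (simple_coroot D) J ((c i)%:~R *: simple_coroot D i).
    by apply: qspanZ; [exact: rpred_int|exact: qspan_simple].
  split=> [|eta he]; first exact: qspanT q.
  rewrite transD; last exact: qspanT q.
  apply: sge_parabolic; first exact: Waf_trans.
  by split=> //; exact: parabolic1.
have : 0 <= c i.
  have := hle i iJ; rewrite /simple_coroot /coroot.
  under eq_bigr do rewrite scalerA.
  rewrite coef_comb inE pmulr_lge0 ?ler0z // divr_gt0 // dot_gt0.
  exact: alpha_nz.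
case: (c i) => // m _; rewrite -[(Posz m)%:~R]/(m%:R) scaler_nat.
by elim: m => [|m IH]; rewrite ?mulr0n // mulrS; apply: MD.
Qed.

(** * Reduction to translations *)

Lemma edge_slen J y x : semi_infinite_edge D J y x -> slen J y <= slen J x.
Proof.
by move=> [my mx [c [_ _]]]; rewrite -!(@min_coset_slen _ _ D J) // => ->; rewrite lerDl.
Qed.

Lemma sge_slen J x y : Waf x -> Waf y -> sge J x y -> slen J y <= slen J x.
Proof.
move=> hx hy; rewrite -(slen_proj J hx) -(slen_proj J hy) /sge.
elim=> {hx hy} [p q|p|p q r _ h1 _ h2]; [exact: edge_slen|by []|].
exact: le_trans h1 h2.
Qed.

(** A simple reflection which lowers the length relative to [set0] lowers or keeps
    the coset modulo [J], for every [J] at once.  So lifting downwards gives one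
    implication, and lifting upwards or transitivity the other. *)
Lemma sge_lower b z y J : asimple b -> Waf z -> Waf y ->
  ht set0 (dir b z) < 0 ->
  sge J (refl b ** z) (down set0 b y) <-> sge J z y.
Proof.
move=> hs hz hy dz; have hb := asimple_root hs; have hr := Waf_refl hb.
have hdz := dir_root hz hb; have hdy := dir_root hy hb.
have le0 d : d \in Phi -> ht set0 d < 0 -> ht J d <= 0.
  move=> dD hd; have := @ht_geW _ _ D J (- d); rewrite rootNE !htN oppr_gt0 oppr_ge0.
  by apply.
have dzJ := le0 _ hdz dz.
have szz : sge J z (refl b ** z) by exact: sge_simple_down.
have zsz : sge J (down J b z) (refl b ** z) /\ sge J (refl b ** z) (down J b z).
  rewrite /down; case: ltP => h; first by split; exact: sge_refl.
  split=> //; apply: sge_simple_up => //.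
have upz : sge J z (up J b (refl b ** z)).
  rewrite /up (dir_refl hz hb) htN oppr_gt0; case: ltP => h //.
  by rewrite (reflK hb hz); exact: sge_refl.
rewrite /down; case: ltP => dy.
  have dyJ := le0 _ hdy dy; split=> h.
    have h1 := sge_up hs (WafM hr hz) (WafM hr hy) h.
    apply: sge_trans upz (sge_trans h1 _).
    rewrite /up (dir_refl hy hb) htN oppr_gt0; case: ltP => h'.
      by rewrite (reflK hb hy); exact: sge_refl.
    exact: sge_simple_up.
  have h1 := sge_down hs hz hy h.
  apply: sge_trans zsz.2 (sge_trans h1 _).
  rewrite /down; case: ltP => h'; first exact: sge_refl.
  exact: sge_simple_down.
have dyJ : 0 <= ht J (dir b y).
  by apply: ht_geW => //; rewrite lt_def dy ht0_neq0.
split=> h; first exact: sge_trans szz h.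
have h1 := sge_down hs hz hy h.
apply: sge_trans zsz.2 (sge_trans h1 _).
by rewrite {1}/down ltNge dyJ; exact: sge_refl.
Qed.

Lemma down_Waf J b z : asimple b -> Waf z -> Waf (down J b z).
Proof.
move=> hs hz; rewrite /down; case: ifP => // _.
by apply: WafM => //; apply: Waf_refl; exact: asimple_root.
Qed.

(** Pairing with [rhoc set0] is positive on the positive roots.  Up to signs [w]
    permutes these, and it makes at least one of them negative. *)
Lemma dot_rhoc_weyl w : weyl D w -> w <> 1%:M ->
  dot (w^T *m rhoc set0) (root_sum set0) < dot (rhoc set0) (root_sum set0).
Proof.
move=> hw w1; rewrite dot_mulmx trmxK mulmx_sumr !dot_sumr.
pose G e := dot (rhoc set0) e.
have GN e : G (- e) = - G e by rewrite /G dotNr.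
have even (h : 'cV[R]_n -> R) : (forall e, h (- e) = h e) ->
    \sum_(e <- Phi) h e = 2 * \sum_(e <- Phi | 0 < ht set0 e) h e.
  move=> hh; rewrite (bigID (fun e => 0 < ht set0 e)) /=.
  suff -> : \sum_(e <- Phi | ~~ (0 < ht set0 e)) h e =
      \sum_(e <- Phi | 0 < ht set0 e) h e by ring.
  have -> : \sum_(e <- Phi | ~~ (0 < ht set0 e)) h e =
      \sum_(e <- [seq - e | e <- Phi] | ~~ (0 < ht set0 e)) h e.
    apply: perm_big; apply: uniq_perm; rewrite ?(map_inj_uniq oppr_inj) ?fset_uniq //.
    move=> e; apply/idP/mapP => [eD|[f fD ->]]; last by rewrite rootNE.
    by exists (- e); rewrite ?opprK // rootNE.
  rewrite big_map big_seq_cond [RHS]big_seq_cond; apply: eq_big => [e|e _].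
    case: (boolP (e \in Phi)) => //= eD; rewrite htN oppr_gt0.
    by have := ht0_neq0 eD; case: ltgtP.
  exact: hh.
have pos e : e \in Phi -> 0 < ht set0 e -> 0 < G e by exact: dot_rhoc_gt0.
have -> : \sum_(e <- Phi | 0 < ht set0 e) dot (rhoc set0) e =
    \sum_(e <- Phi | 0 < ht set0 e) `|G (w *m e)|.
  transitivity (\sum_(e <- Phi | 0 < ht set0 e) `|G e|).
    rewrite big_seq_cond [RHS]big_seq_cond; apply: eq_bigr => e /andP[eD pe].
    by rewrite gtr0_norm ?pos.
  apply: (mulfI (_ : 2 != 0 :> R)); first by rewrite pnatr_eq0.
  rewrite -!even => [|e|e]; last 1 first.
  - by rewrite GN normrN.
  - by rewrite (sum_weyl (fun e => `|G e|) hw).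
  - by rewrite mulmxN GN normrN.
rewrite -subr_gt0 -sumrB.
have [e [eD pe ne]] : exists e, [/\ e \in Phi, 0 < ht set0 e & ht set0 (w *m e) < 0].
  apply: contrapT => hN; apply: w1; apply: (weyl_ninv0 hw).
  rewrite /ninv big_seq_cond big1 // => e /andP[eD pe]; apply/eqP; rewrite eqb0.
  by apply/negP => ne; apply: hN; exists e.
apply: (sum_root_gt0 _ eD) => // [f fD pf|].
  by rewrite subr_ge0 ler_norm.
have := pos (- (w *m e)); rewrite rootNE weyl_root // htN oppr_gt0 => /(_ eD ne).
rewrite GN oppr_gt0 => hG; rewrite subr_gt0 (lt_trans hG) //.
by rewrite normr_gt0 lt_eqF.
Qed.

(** Translating further by [rhoc set0] makes up for the inversions of [y], so the
    counts of this translation are at least those of [y]. *)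
Lemma sge_above y : Waf y -> sge set0 (trans (y.2 + rhoc set0)) y.
Proof.
move=> hy; have hq : Qvee (y.2 + rhoc set0).
  by apply: qspanD; [case: hy|exact: qspan_rhoc].
apply: (@descent_ind _ _ D set0 (sge set0 (trans (y.2 + rhoc set0)))
  (trans (y.2 + rhoc set0))) => //.
- exact: Waf_trans.
- move=> e eD pe; rewrite cnt_trans // dotDl /cnt lerD2l.
  by apply: le_trans (dot_rhoc_ge1 eD pe); case: (_ < 0) => //=; rewrite ?ler01.
- by move=> e eD pe he; rewrite he ltxx in pe.
- exact: sge_refl.
- move=> z b hz hs dz h; apply: sge_trans h _.
  by apply: sge_simple_down; rewrite ?ltW.
Qed.

(** One pair serves for all [J] at once, which is what relates the comparisons
    modulo different [J]. *)
Definition same_order x y x' y' : Prop :=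
  forall J, sge J x y <-> sge J x' y'.

(** The element [trans xi] is lowered to [trans (xi - rhoc set0)], and [y] follows.
    If [y] is not a translation, it is not lowered at every step, so that the
    lengths of the two come closer.  This cannot go on forever: multiplication
    by [trans kappa] commutes with the lowering, and [trans (xi + kappa)] stays
    above [y]. *)
Lemma reduce_to_translations_aux kappa xi y : Qvee kappa -> Qvee xi ->
  Waf y -> sge set0 (trans (xi + kappa)) y ->
  exists xi' zeta, [/\ Qvee xi', Qvee zeta &
    same_order (trans xi) y (trans xi') (trans zeta)].
Proof.
move=> hk.
pose f (p : 'cV[R]_n * affine R n) := slen set0 (trans (p.1 + kappa)) - slen set0 p.2.
pose P (p : 'cV[R]_n * affine R n) := Qvee p.1 -> Waf p.2 ->
  sge set0 (trans (p.1 + kappa)) p.2 ->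
  exists xi' zeta, [/\ Qvee xi', Qvee zeta &
    same_order (trans p.1) p.2 (trans xi') (trans zeta)].
suff H : forall p, P p by move=> h1 h2 h3; exact: (H (xi, y)).
apply: (@real_induction _ f P) => [[{}xi {}y] IH|[{}xi {}y]]; last first.
  rewrite /f /P /= subr_lt0 => h1 h2 h3 h4.
  by have := sge_slen (Waf_trans (qspanD h2 hk)) h3 h4; rewrite leNgt h1.
rewrite /P /= => hxi hy hab; have [hw hy2] := hy.
have [y1|y1] := pselect (y.1 = 1%:M).
  exists xi, y.2; split=> //; have -> // : y = trans y.2.
  by rewrite /trans -y1 -surjective_pairing.
have hx := Waf_trans hxi; have hrho := qspan_rhoc D set0; have hNrho := qspanN hrho.
set x := trans xi in hx *.
pose d := slen set0 x - slen set0 y.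
(* Here [z] and [y'] are the lowered [x] and [y].  The last alternative says that
   [y'] has followed at every step so far. *)
pose T z := Waf z /\ exists y', [/\ Waf y', same_order z y' x y,
  sge set0 (z ** trans kappa) y' &
  slen set0 z - slen set0 y' <= d - 1 \/
  slen set0 z - slen set0 y' = d /\ y' = z ** (ainv x ** y)].
have : T (x ** trans (- rhoc set0)).
  apply: (@descent_ind _ _ D set0 T x) => //.
  - by apply: WafM => //; exact: Waf_trans.
  - move=> e eD pe; rewrite cnt_mul_trans // dotNl gerDl oppr_le0.
    exact: dot_rhoc_ge0.
  - by move=> e eD pe he; rewrite he ltxx in pe.
  - split=> //; exists y; split=> //; first by rewrite -transD.
    right; split=> //; rewrite (amulA _ (WafV hx) hy) (amulV hx).
    by rewrite (a1mul hy).
  move=> z b hz hs dz [_ [y' [hy' eq' ab' alt']]].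
  have hb := asimple_root hs; have hr := Waf_refl hb.
  split; first exact: WafM.
  exists (down set0 b y'); split; first exact: down_Waf.
  - by move=> J; rewrite -(eq' J); exact: sge_lower.
  - have hzk : Waf (z ** trans kappa) by apply: WafM => //; exact: Waf_trans.
    have := sge_down hs hzk hy' ab'.
    rewrite {1}/down (dir_mul_trans _ _ hk) dz (amulA _ hz) //.
    exact: Waf_trans.
  rewrite (slen_simple_down hs hz dz) /down; case: ltP => dy.
    rewrite (slen_simple_down hs hy' dy).
    case: alt' => [h|[h1 h2]]; [left; lra|right; split; first lra].
    rewrite h2 (amulA _ hz) //; apply: WafM => //; exact: WafV.
  by left; case: alt' => [h|[h1 h2]]; lra.
have zE : x ** trans (- rhoc set0) = trans (xi - rhoc set0) by rewrite -transD.
case=> _ [y' [hy' eq' ab' alt']].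
have hxi' : Qvee (xi - rhoc set0) by exact: qspanD.
rewrite zE in eq' ab' alt'; rewrite -transD // in ab'.
case: alt' => [lt'|[e ye]].
  have [] := IH (xi - rhoc set0, y') _ hxi' hy' ab'.
    move: lt'; rewrite /f /d /x /= !transD // !slen_mul_trans //; lra.
  move=> xi2 [zeta [h1 h2 h3]]; exists xi2, zeta; split=> // J.
  by rewrite -(eq' J).
exfalso; have lt_w := dot_rhoc_weyl hw y1.
have hq : int_span (simple_coroot D) [set: 'I_n] (- (y.1^T *m rhoc set0)).
  by apply: qspanN; apply: qspan_parabolic => //; exact: weylV.
have y'E : y' = y ** trans (- (y.1^T *m rhoc set0)).
  rewrite ye -zE (amulA _ (WafV hx) hy) -(amulA _ (Waf_trans hNrho) (WafV hx)).
  have -> : x ** (trans (- rhoc set0) ** ainv x) = trans (- rhoc set0).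
    rewrite (amulA _ (Waf_trans hNrho) (WafV hx)) (mul_trans _ hNrho).
    rewrite (amulE _ (WafV hx)) /= trmx1 trmx1 !mul1mx /trans; congr (_, _).
    by rewrite addrAC subrr add0r.
  rewrite (amulE _ hy) (mul_trans _ hq) /= mul1mx mulmxN; congr (_, _).
  by rewrite addrC.
move: e; rewrite y'E transD // !slen_mul_trans // /d /x !dotNl.
by lra.
Qed.

Lemma reduce_to_translations x y : Waf x -> Waf y ->
  exists xi zeta, [/\ Qvee xi, Qvee zeta &
    same_order x y (trans xi) (trans zeta)].
Proof.
move=> hx hy; have [_ hx2] := hx; have hrho := qspan_rhoc D set0.
have hq : Qvee (x.2 - rhoc set0) by apply: qspanD => //; exact: qspanN.
pose T z := Waf z /\ exists2 y', Waf y' & same_order x y z y'.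
have [_ [y' hy' e]] : T (trans (x.2 - rhoc set0)).
  apply: (@descent_ind _ _ D set0 T x) => //.
  - exact: Waf_trans.
  - move=> e eD pe; rewrite cnt_trans // dotBl /cnt lerD2l.
    by apply: (@le_trans _ _ 0); rewrite ?ler0n // oppr_le0 dot_rhoc_ge0.
  - by move=> e eD pe he; rewrite he ltxx in pe.
  - by split=> //; exists y.
  move=> z b hz hs dz [_ [y' hy' e]]; split.
    by apply: WafM => //; apply: Waf_refl; exact: asimple_root.
  exists (down set0 b y'); first exact: down_Waf.
  by move=> J; rewrite (e J); apply: iff_sym; exact: sge_lower.
have hy'2 := proj2 hy'.
have hk : Qvee (y'.2 + rhoc set0 - (x.2 - rhoc set0)).
  by apply: qspanD; [exact: qspanD|exact: qspanN].
have hab := sge_above hy'.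
have [] := @reduce_to_translations_aux _ (x.2 - rhoc set0) y' hk hq hy'.
  by rewrite addrC subrK.
move=> xi [zeta [h1 h2 h3]]; exists xi, zeta; split=> // J.
by rewrite (e J).
Qed.

End Criterion.

Theorem theorem3p1 (R : realType) (n : nat) (D : simpleRootSystem R n)
    (s : nat) (J : {set 'I_n}) (K : 'I_s -> {set 'I_n}) (x y : affine R n) :
  (0 < s)%N ->
  J = (\bigcap_(nu < s) K nu)%SET ->
  affine_min_coset D J x -> affine_min_coset D J y ->
  (semi_infinite_ge D J x y <->
   forall nu : 'I_s,
     semi_infinite_ge D (K nu)
       (affine_proj D (K nu) x) (affine_proj D (K nu) y)).
Proof.
move=> _ eJ mx my.
have [xi [zeta [hxi hzeta h]]] :=
  reduce_to_translations (min_coset_Waf mx) (min_coset_Waf my).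
have hJ := h J; rewrite /sge (proj_id mx) (proj_id my) in hJ.
split=> [hxy nu|hxy].
  apply/(h (K nu))/(sge_transE _ hxi hzeta) => i iK.
  apply: (proj1 (sge_transE J hxi hzeta)); first exact: (proj1 hJ).
  by apply: contraNN iK; rewrite eJ => /finset.bigcapP; apply.
apply/hJ/(sge_transE _ hxi hzeta) => i iJ.
have [nu iK] : exists nu, i \notin K nu.
  apply: contrapT => hN; move/negP: iJ; apply; rewrite eJ.
  apply/finset.bigcapP => nu _; apply: contrapT => /negP iK.
  by apply: hN; exists nu.
by apply: (proj1 (sge_transE (K nu) hxi hzeta)) iK; apply/(h (K nu))/hxy.
Qed.
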